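(* Let $\pi$ be a curve-like solid partition. For every $i,j\in\{1,2,3,4\}$, $$(-1)^{\sigma_i(\pi)}\,e^{\mathbf{T}}(-{\mathsf{v}^{i}_\pi}')=(-1)^{\sigma_j(\pi)}\,e^{\mathbf{T}}(-{\mathsf{v}^{j}_\pi}'),$$ where ${\mathsf{v}^{i}_\pi}'$, $\sigma_i(\pi)$ and $e^{\mathbf{T}}$ are as defined in the context.
   Context: Torus and representation ring. $\mathbf{T}=\{t_1t_2t_3t_4=1\}\subset(\mathbb{C}^* )^4$, and $K^0_{\mathbf{T}}(\mathrm{pt})=\mathbb{Z}[t_1^{\pm1},t_2^{\pm1},t_3^{\pm1},t_4^{\pm1}]/(t_1t_2t_3t_4-1)$ is the ring of virtual $\mathbf{T}$-representations. $\overline{(\cdot)}$ denotes the dual, i.e. the involution $t_a\mapsto t_a^{-1}$, extended to rational functions. For a set of indices $I$, $P_I=\prod_{a\in I}(1-t_a)$, so $\overline{P_I}=\prod_{a\in I}(1-t_a^{-1})$. Movable classes and Euler class. A class $V=\sum_\mu m_\mu t^\mu\in K^0_{\mathbf{T}}(\mathrm{pt})$ (sum over distinct characters of $\mathbf{T}$, $m_\mu\in\mathbb{Z}$) is $\mathbf{T}$-movable if the trivial character has multiplicity $0$ in $V$. Put $\lambda^{\mathrm{wt}}_a=c_1^{\mathbf{T}}(t_a)$, so that $\sum_a\lambda^{\mathrm{wt}}_a=0$. For $\mathbf{T}$-movable $V$, $e^{\mathbf{T}}(V)=\prod_\mu(\sum_a\mu_a\lambda^{\mathrm{wt}}_a)^{m_\mu}$,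 an element of the fraction field of $\mathbb{Q}[\lambda^{\mathrm{wt}}_1,\dots,\lambda^{\mathrm{wt}}_4]/(\sum_a\lambda^{\mathrm{wt}}_a)$. Solid partitions. A solid partition is a subset $\pi\subset\mathbb{Z}^4_{\geq0}$, possibly infinite, closed under passing to componentwise smaller elements of $\mathbb{Z}^4_{\ge0}$. Its asymptotic plane partition $\lambda_a\subset\mathbb{Z}^3_{\geq0}$ along the $x_a$-axis ($a=1,\dots,4$) is the set of triples (indexed by the three coordinates other than $a$) such that the point with these coordinates and arbitrary $a$-th coordinate $k_a\ge0$ lies in $\pi$. All $\lambda_a$ are assumed finite. $\pi$ is curve-like if at least one $\lambda_a$ is nonempty. The renormalized volume is $|\pi|=\#(\pi\cap[0,N]^4)-(N+1)\sum_{a=1}^4|\lambda_a|$ for $N\gg0$ (independent of $N$ large). For each $a$, $\mathrm{leg}_a\subset\pi$ is the solid partition of all points whose three coordinates other than the $a$-th form an element of $\lambda_a$. Generating functions. $Z_\pi=\sum_{(a_1,\dots,a_4)\in\pi}t_1^{a_1}t_2^{a_2}t_3^{a_3}t_4^{a_4}$, regarded as a rational function (summing geometric series along the legs). For $\{a,b,c,d\}=\{1,2,3,4\}$ with $b<c<d$, $Z_{\lambda_a}=\sum_{(p,q,r)\in\lambda_a}t_b^{p}t_c^{q}t_d^{r}$. Square roots. For $\{i,j,k,l\}=\{1,2,3,4\}$ put $$\mathsf{v}^i_\pi=Z_\pi-\overline{P_{jkl}}Z_\pi\overline{Z_\pi}+\sum_{a\neq i}\frac{\mathsf{f}^i_{\lambda_a}}{1-t_a}+\frac{1}{1-t_i}\left(-Z_{\lambda_i}+\overline{P_{jkl}}\left(\overline{Z_\pi}Z_{\lambda_i}-Z_\pi\overline{Z_{\lambda_i}}\right)+\frac{\overline{P_{jkl}}}{1-t_i}Z_{\lambda_i}\overline{Z_{\lambda_i}}\right),$$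 where, for $a\ne i$, $\mathsf{f}^i_{\lambda_a}=-Z_{\lambda_a}+\overline{P_{cd}}\,Z_{\lambda_a}\overline{Z_{\lambda_a}}$ with $\{i,a,c,d\}=\{1,2,3,4\}$. Fix a sufficiently large integer $N$ (the same for all $i$). Let $\pi^{\mathrm{nor}}=\pi\cap[0,N]^4$ with generating function $Z_{\pi^{\mathrm{nor}}}$, so that $Z_\pi=Z_{\pi^{\mathrm{nor}}}+\sum_{a=1}^4\frac{Z_{\lambda_a}}{1-t_a}t_a^{N+1}$, and let $Z_{\pi_a}=Z_{\lambda_a}\sum_{n=0}^Nt_a^n$. Put $$C^i_\pi=\overline{P_{jkl}}\left(Z_{\pi_i}\left(\overline{Z_{\pi^{\mathrm{nor}}}}-\overline{Z_{\pi_i}}\right)+\sum_{a\neq i}\frac{\overline{Z_{\lambda_a}}}{1-t_a^{-1}}t_a^{-(N+1)}Z_{\pi_i}\right),\qquad {\mathsf{v}^{i}_\pi}'=\mathsf{v}^i_\pi-C^i_\pi+\overline{C^i_\pi}.$$ These are elements of $K^0_{\mathbf{T}}(\mathrm{pt})$, and ${\mathsf{v}^{i}_\pi}'$ is $\mathbf{T}$-movable, so $e^{\mathbf{T}}(-{\mathsf{v}^{i}_\pi}')$ is defined. Sign. For $\{i,j,k,l\}=\{1,2,3,4\}$, $$\sigma_i(\pi)=|\pi|+\#\{(a_1,a_2,a_3,a_4)\in\pi: a_j=a_k=a_l<a_i\}-\sum_{b=1}^4\#\{(a_1,a_2,a_3,a_4)\in\mathrm{leg}_b: a_j=a_k=a_l<a_i\},$$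 where, since individual counts may be infinite, the difference of counts is computed after intersecting $\pi$ and all $\mathrm{leg}_b$ with $[0,M]^4$ for $M\gg0$ (the result does not depend on $M$ large). *)

(* Defs.v *)
From HB Require Import structures.
From mathcomp Require Import freeg mpoly.
From mathcomp Require Import all_boot all_order all_algebra.
From mathcomp Require Import fraction finmap.
From mathcomp Require Import boolp classical_sets functions cardinality fsbigop.

Set Implicit Arguments.
Unset Strict Implicit.
Unset Printing Implicit Defensive.

Import Order.TTheory GRing.Theory Num.Theory.
Local Open Scope classical_set_scope.
Local Open Scope ring_scope.

(** Conventions.  The indices 1, 2, 3, 4 are the elements of ['I_4].  For
    [a : 'I_4], [lift a : 'I_3 -> 'I_4] enumerates in increasing order the three
    indices other than [a]. *)

(** The value at which a sequence is eventually constant ("for N >> 0"). *)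
Definition stable_value (V : zmodType) (u : nat -> V) : V :=
  xget 0 [set v | exists N0 : nat, forall N : nat, (N0 <= N)%N -> u N = v].

(** * Solid partitions *)

Notation npoint n := {ffun 'I_n -> nat}.

Definition solid_partition (pi : set (npoint 4)) : Prop :=
  forall x y : npoint 4, pi y -> (forall a, (x a <= y a)%N) -> pi x.

Definition insert_coord (a : 'I_4) (k : nat) (p : npoint 3) : npoint 4 :=
  [ffun c => if unlift a c is Some j then p j else k].

Definition delete_coord (a : 'I_4) (x : npoint 4) : npoint 3 :=
  [ffun j => x (lift a j)].

Definition asymptotic (pi : set (npoint 4)) (a : 'I_4) : set (npoint 3) :=
  [set p | forall k : nat, pi (insert_coord a k p)].

Definition finite_asymptotics (pi : set (npoint 4)) : Prop :=
  forall a : 'I_4, finite_set (asymptotic pi a).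

Definition curve_like (pi : set (npoint 4)) : Prop :=
  exists a : 'I_4, asymptotic pi a !=set0.

Definition leg (pi : set (npoint 4)) (a : 'I_4) : set (npoint 4) :=
  [set x | asymptotic pi a (delete_coord a x)].

Definition box (N : nat) : set (npoint 4) :=
  [set x | forall a, (x a <= N)%N].

(** Used on finite sets only: [fset_set A] is empty if [A] is infinite. *)
Definition ncard (T : choiceType) (A : set T) : nat := #|` fset_set A|.

Definition renormalized_volume (pi : set (npoint 4)) : int :=
  stable_value (fun N : nat =>
    (ncard (pi `&` box N))%:Z
    - (N.+1)%:Z * \sum_(a < 4) (ncard (asymptotic pi a))%:Z).

(** The points with [a_j = a_k = a_l < a_i], where [{i,j,k,l} = {1,2,3,4}]. *)
Definition dominant_diagonal (i : 'I_4) : set (npoint 4) :=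
  [set x | forall j k : 'I_4, j != i -> k != i ->
             x j = x k /\ (x j < x i)%N].

Definition sigma (i : 'I_4) (pi : set (npoint 4)) : int :=
  renormalized_volume pi
  + stable_value (fun M : nat =>
      (ncard (pi `&` box M `&` dominant_diagonal i))%:Z
      - \sum_(b < 4) (ncard (leg pi b `&` box M `&` dominant_diagonal i))%:Z).

(** * Rational functions of the torus coordinates

    A rational function on the torus is written as a function of the coordinates
    [t : 'I_4 -> F] in a field [F]; it is evaluated below at the generic point
    of the torus, with [F] the function field.  In this form the involution
    [t_a |-> t_a^-1] is precomposition with the inversion of the coordinates. *)

Section RationalFunctions.
Variable F : fieldType.
Implicit Type t : 'I_4 -> F.

Definition dual (f : ('I_4 -> F) -> F) : ('I_4 -> F) -> F :=
  fun t => f (fun a => (t a)^-1).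

Definition Pfun (I : {set 'I_4}) t : F := \prod_(a in I) (1 - t a).

Variable pi : set (npoint 4).

(** [Z_{lambda_a}] *)
Definition Zasym (a : 'I_4) t : F :=
  \sum_(p \in asymptotic pi a) \prod_(j < 3) t (lift a j) ^+ p j.

(** The generating function of [pi `&` box N], that is, of [pi^nor]. *)
Definition Znor (N : nat) t : F :=
  \sum_(x \in pi `&` box N) \prod_(a < 4) t a ^+ x a.

(** Outside a large box, [pi] is the disjoint union of the ends of its legs; the
    geometric series of these ends are summed.  The result does not depend on
    the (large) box. *)
Definition Zpi t : F :=
  stable_value (fun N : nat =>
    Znor N t + \sum_(a < 4) Zasym a t / (1 - t a) * t a ^+ N.+1).

(** [f^i_{lambda_a}], for [a != i]. *)
Definition fleg (i a : 'I_4) t : F :=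
  - Zasym a t + dual (Pfun (~: [set i; a])) t * Zasym a t * dual (Zasym a) t.

(** [v^i_pi] *)
Definition vertex (i : 'I_4) t : F :=
  let Pjkl := dual (Pfun (~: [set i])) t in
  Zpi t - Pjkl * Zpi t * dual Zpi t
  + \sum_(a < 4 | a != i) fleg i a t / (1 - t a)
  + (1 - t i)^-1 *
      (- Zasym i t
       + Pjkl * (dual Zpi t * Zasym i t - Zpi t * dual (Zasym i) t)
       + Pjkl / (1 - t i) * Zasym i t * dual (Zasym i) t).

(** [Z_{pi_a}] *)
Definition Zleg (N : nat) (a : 'I_4) t : F :=
  Zasym a t * \sum_(n < N.+1) t a ^+ n.

(** [C^i_pi] *)
Definition correction (N : nat) (i : 'I_4) t : F :=
  dual (Pfun (~: [set i])) t *
    (Zleg N i t * (dual (Znor N) t - dual (Zleg N i) t)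
     + \sum_(a < 4 | a != i)
         dual (Zasym a) t / (1 - (t a)^-1) * t a ^- N.+1 * Zleg N i t).

(** [v^i_pi'] *)
Definition vertex' (N : nat) (i : 'I_4) t : F :=
  vertex i t - correction N i t + dual (correction N i) t.

End RationalFunctions.

(** * Representations of the torus

    The torus [t_1 t_2 t_3 t_4 = 1] has coordinates [t_1, t_2, t_3], with
    [t_4 = (t_1 t_2 t_3)^-1]; accordingly its character lattice is ['rV[int]_3]
    and its function field is Q(t_1, t_2, t_3).  Likewise the fraction field of
    Q[lambda_1, ..., lambda_4]/(lambda_1 + ... + lambda_4) is
    Q(lambda_1, lambda_2, lambda_3), with
    [lambda_4 = - (lambda_1 + lambda_2 + lambda_3)].  Both fields are
    represented by the same type. *)

Notation ratfun3 := {fraction {mpoly rat[3]}}.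

Definition var3 (j : 'I_3) : ratfun3 := FracField.tofrac 'X_j.

(** The generic point of the torus. *)
Definition tgen (a : 'I_4) : ratfun3 :=
  if unlift ord_max a is Some j then var3 j else (\prod_(j < 3) var3 j)^-1.

(** The equivariant first Chern classes of the [t_a]. *)
Definition lambda_wt (a : 'I_4) : ratfun3 :=
  if unlift ord_max a is Some j then var3 j else - \sum_(j < 3) var3 j.

(** Virtual representations: finitely supported functions from characters to
    multiplicities. *)
Notation K0 := {freeg 'rV[int]_3 / int}.

(** [V] as a rational function on the torus. *)
Definition K0_ratfun (V : K0) : ratfun3 :=
  \sum_(mu <- dom V)
    (\prod_(j < 3) tgen (lift ord_max j) ^ mu 0 j) *~ coeff mu V.

Definition movable (V : K0) : Prop := coeff 0 V = 0.

(** Meaningful for movable [V] only: the trivial character has weight 0. *)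
Definition euler (V : K0) : ratfun3 :=
  \prod_(mu <- dom V)
    (\sum_(j < 3) lambda_wt (lift ord_max j) *~ mu 0 j) ^ coeff mu V.

(* Main.v *)
From mathcomp Require Import freeg mpoly.
From mathcomp Require Import all_boot all_order all_algebra.
From mathcomp Require Import fraction finmap.
From mathcomp Require Import boolp classical_sets functions cardinality fsbigop.
From mathcomp Require Import zify ring.
Require Import Defs.

Set Implicit Arguments.
Unset Strict Implicit.
Unset Printing Implicit Defensive.

Import Order.TTheory GRing.Theory Num.Theory.
Local Open Scope classical_set_scope.
Local Open Scope ring_scope.

(** Notation of this explanation: f~ is the dual of f, P is the product of all
    1 - t_a, Q_i is the dual of P_jkl, X and Y_a are the generating functions of
    the parts of pi and of its a-th leg in the box [0,N]^4, L_a = Z_{lambda_a},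
    and E_a = L_a t_a^(N+1) / (1 - t_a) is the end of the a-th leg.

    Closed form.  On the torus, Q_i = - t_i P_jkl, hence P = Q_i + Q_i~.  Putting
    Z_pi = X + sum_a E_a and L_a / (1 - t_a) = Y_a + E_a into the definition gives
    ([vertex'E])
      v_i' = (X - sum_a Y_a) - Q_i X X~ - sum_a P X E_a~ + (U_i - U_i~)
             - sum_(a != i) (Q_i X~ E_a - dual)
             - (terms Q_i E_a E_b~ and P E_b E_i~ with a, b, i distinct),
    where U_i = Q_i L_i L_i~ (sum over n <= m <= N of t_i^n).  Every denominator
    1 - t_a of an E_a is cancelled by a factor of Q_i or P, so each term is a
    Laurent polynomial.

    Reduction to multiplicities.  As P = Q_i + Q_i~ does not depend on i and
    Q_i - Q_j = R - R~ with R = t_j P_kl, the closed form yields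
    v_i' - v_j' = U - U~ for an explicit Laurent polynomial U
    ([vertex'_difference]).  A nontrivial character mu of multiplicity m in U
    contributes (- mu / mu)^m = (-1)^m to e(U~ - U), so the two Euler classes
    differ by the sign (-1)^(rk U - U_0), where rk is the value at t = 1 and U_0 the
    multiplicity of the trivial character ([euler_dual_shift]).  Here rk U = 0,
    because every term of U keeps a factor 1 - t_b.  So movability and the
    comparison of signs both come down to multiplicities of the trivial character;
    the predicate [laurent f n r] records that f is a Laurent polynomial in which
    this multiplicity is n and whose rank is r.

    Counting.  The trivial character of the torus is represented by all multiples
    of (1,1,1,1).  For a finite set X of boxes, its multiplicity in
    t^(-q) sum_(x in X) t^x is the number of x in X on the line q + Z(1,1,1,1), and
    multiplication by 1 - t_b turns this function of q into its backward
    difference in the direction b.  If X is an order ideal near that line, the line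
    meets X in a segment that starts on the boundary of the orthant, and the
    iterated difference only asks at which corner of the orthant it starts
    ([backward_diffs_class_count]).  This treats P X E_a~ and Q_i X~ E_a directly;
    X X~ and L_i L_i~ are built up one maximal box at a time
    ([laurent_selfproduct]); the products E_a E_b~ contain no trivial character, as
    the legs leave the box far from one another.

    The outcome: Q_i X X~ counts the boxes of X with equal coordinates, and
    P X E_a~ counts those of the legs with the opposite sign, so v_i' is movable;
    U_i and the terms Q_i X~ E_a count the boxes with a_j = a_k = a_l <= a_i in the
    legs, and R X X~ counts, modulo 2, those of X with a_j = a_k = a_l < a_i or
    a_i = a_k = a_l < a_j.  The boxes of the legs with equal coordinates occur both
    for i and for j and cancel in v_i' - v_j'.  Hence U_0 has the parity of sigma_i - sigma_j
    ([sigma_parity]). *)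

(** * Laurent polynomials on the torus *)

Section Laurent.
Variable F : fieldType.
Implicit Types (t : 'I_4 -> F) (f g : ('I_4 -> F) -> F) (p q : 'I_4 -> int).

Definition torus_point t : Prop :=
  [/\ forall a, t a != 0, forall a, t a != 1 & \prod_a t a = 1].

Lemma torus_point_inv t : torus_point t -> torus_point (fun a => (t a)^-1).
Proof.
case=> t0 t1 tp; split=> [a|a|]; rewrite ?invr_eq0 //.
  by rewrite -[1]invr1 (inj_eq invr_inj).
by rewrite prodfV tp invr1.
Qed.

Definition mono3 t (mu : 'rV[int]_3) : F :=
  \prod_(j < 3) t (lift ord_max j) ^ mu 0 j.

Definition char t q : F := \prod_a t a ^ q a.

(** The character of the torus defined by a weight in Z^4. *)
Definition weight_class q : 'rV[int]_3 := \row_j (q (lift ord_max j) - q ord_max).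

(** The condition [\prod_a t a = 1] eliminates the last coordinate, so that a weight
    in Z^4 only matters modulo (1,1,1,1). *)
Lemma charE t q : torus_point t -> char t q = mono3 t (weight_class q).
Proof.
case=> t0 _ tp; have tE : t ord_max = (\prod_(j < 3) t (lift ord_max j))^-1.
  rewrite -[t ord_max]invrK; congr _^-1; rewrite -[RHS](mulKf (t0 ord_max)).
  by move: tp; rewrite (bigD1_ord ord_max) //= => ->; rewrite mulr1.
rewrite /char /mono3 (bigD1_ord ord_max) //= tE exprz_inv.
have -> : (\prod_(j < 3) t (lift ord_max j)) ^ (- q ord_max) =
          \prod_(j < 3) t (lift ord_max j) ^ (- q ord_max).
  by elim/big_rec2 : _ => [|j x y _ <-]; rewrite ?exp1rz // expfzMl.
rewrite -big_split /=; apply: eq_bigr => j _.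
by rewrite -expfzDr // mxE addrC.
Qed.

Lemma charD t p q : torus_point t ->
  char t (fun a => p a + q a) = char t p * char t q.
Proof. by case=> t0 _ _; rewrite -big_split; apply: eq_bigr => a _; rewrite expfzDr. Qed.

Lemma char_delta t b q : torus_point t ->
  t b * char t (fun a => - q a) = char t (fun a => - (q a - (a == b)%:Z)).
Proof.
move=> tt; rewrite -[t b](_ : char t (fun a => (a == b)%:Z) = _) -?charD //.
  by congr char; apply/funext => a; rewrite opprB.
rewrite /char (bigD1 b) //= eqxx expr1z big1 ?mulr1 // => a /negPf ->.
by rewrite expr0z.
Qed.

Definition trivial_weight q : bool := [forall a, q a == q ord_max].

Lemma weight_class_eq0 q : (weight_class q == 0) = trivial_weight q.
Proof.
apply/eqP/forallP => [q0 a|dq].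
  case: (unliftP ord_max a) => [j|] -> //.
  by have /rowP/(_ j) := q0; rewrite !mxE => /eqP; rewrite subr_eq0.
by apply/rowP => j; rewrite !mxE; apply/eqP; rewrite subr_eq0.
Qed.

Lemma mono3_inv t mu : mono3 (fun a => (t a)^-1) mu = mono3 t (- mu).
Proof. by apply: eq_bigr => j _; rewrite mxE exprz_inv. Qed.

Definition laurent_sum (s : seq (int * 'rV[int]_3)) t : F :=
  \sum_(x <- s) mono3 t x.2 *~ x.1.

(** [f] agrees on the torus with a virtual representation in which the trivial
    character has multiplicity [n] and whose rank is [r].  Formal sums of characters
    are used here, with repetitions allowed, because they make sums and duals
    immediate; products never have to be formed, since every product below is
    expanded into monomials. *)
Definition laurent f (n r : int) : Prop :=
  exists s : seq (int * 'rV[int]_3),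
    [/\ forall t, torus_point t -> f t = laurent_sum s t,
        n = \sum_(x <- s | x.2 == 0) x.1 & r = \sum_(x <- s) x.1].

Lemma laurent_ext f g n m r u : laurent g m u ->
  (forall t, torus_point t -> f t = g t) -> n = m -> r = u -> laurent f n r.
Proof.
by case=> s [Hs -> ->] fg -> ->; exists s; split=> // t tt; rewrite fg ?Hs.
Qed.

Lemma laurent0 : laurent (fun=> 0) 0 0.
Proof. by exists [::]; rewrite !big_nil; split=> // t; rewrite /laurent_sum big_nil. Qed.

Lemma laurentD f g n m r u : laurent f n r -> laurent g m u ->
  laurent (fun t => f t + g t) (n + m) (r + u).
Proof.
case=> s [Hs -> ->] [s' [Hs' -> ->]]; exists (s ++ s').
split=> [t tt||]; rewrite ?big_cat //.
by rewrite Hs // Hs' // /laurent_sum big_cat.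
Qed.

Lemma laurentN f n r : laurent f n r -> laurent (fun t => - f t) (- n) (- r).
Proof.
case=> s [Hs -> ->]; exists [seq (- x.1, x.2) | x <- s].
split=> [t tt||]; rewrite ?big_map /=.
- by rewrite Hs // /laurent_sum big_map -sumrN; apply: eq_bigr => x _; rewrite /= mulrNz.
- by rewrite -sumrN.
- by rewrite -sumrN.
Qed.

Lemma laurentB f g n m r u : laurent f n r -> laurent g m u ->
  laurent (fun t => f t - g t) (n - m) (r - u).
Proof. by move=> lf lg; apply: laurentD => //; apply: laurentN. Qed.

Lemma laurent_big (I : Type) (s : seq I) (P : pred I)
    (f : I -> ('I_4 -> F) -> F) (n r : I -> int) :
  (forall i, P i -> laurent (f i) (n i) (r i)) ->
  laurent (fun t => \sum_(i <- s | P i) f i t)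
          (\sum_(i <- s | P i) n i) (\sum_(i <- s | P i) r i).
Proof.
move=> lf; elim: s => [|i s IHs].
  by apply: laurent_ext laurent0 _ _ _ => [t _||]; rewrite big_nil.
have [Pi|nPi] := boolP (P i).
  apply: laurent_ext (laurentD (lf i Pi) IHs) _ _ _ => [t _||];
  by rewrite big_cons Pi.
by apply: laurent_ext IHs _ _ _ => [t _||]; rewrite big_cons (negPf nPi).
Qed.

(** Negating all characters fixes the trivial one. *)
Lemma laurent_dual f n r : laurent f n r -> laurent (dual f) n r.
Proof.
case=> s [Hs -> ->]; exists [seq (x.1, - x.2) | x <- s].
split=> [t tt||]; rewrite ?big_map /=.
- rewrite /dual Hs; last exact: torus_point_inv.
  by rewrite /laurent_sum big_map; apply: eq_bigr => x _; rewrite mono3_inv.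
- by apply: eq_bigl => x; rewrite oppr_eq0.
- by [].
Qed.

Lemma dualK f : dual (dual f) = f.
Proof. by apply/funext => t; rewrite /dual; congr f; apply/funext => a; rewrite invrK. Qed.

Lemma laurent_char q : laurent (char^~ q) (trivial_weight q)%:R 1.
Proof.
exists [:: (1, weight_class q)]; split=> [t tt||].
- by rewrite /laurent_sum big_seq1 charE.
- by rewrite -weight_class_eq0 big_mkcond big_seq1 /=; case: eqP.
- by rewrite big_seq1.
Qed.

(** * Finite differences *)

Definition backward_diff b (h : ('I_4 -> int) -> int) : ('I_4 -> int) -> int :=
  fun q => h q - h (fun a => q a - (a == b)%:Z).

Definition backward_diffs (S : seq 'I_4) h := foldr backward_diff h S.

(** The number of points of [X] that define the same character of the torus as [q]. *)
Definition class_count (X : seq (npoint 4)) q : int :=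
  \sum_(x <- X) (trivial_weight (fun a => (x a)%:Z - q a))%:R.

Definition genfun (X : seq (npoint 4)) t : F := \sum_(x <- X) \prod_a t a ^+ x a.

Lemma laurent_genfun X q :
  laurent (fun t => char t (fun a => - q a) * genfun X t) (class_count X q) (size X)%:R.
Proof.
have := laurent_big X (P := xpredT)
  (fun x _ => laurent_char (fun a => (x a)%:Z - q a)).
move/laurent_ext; apply=> [t tt||] //.
  rewrite /genfun mulr_sumr; apply: eq_bigr => x _.
  by rewrite (charD (fun a => (x a)%:Z) (fun a => - q a)) // mulrC.
by elim: X => [|x X IHX]; rewrite ?big_nil // big_cons -IHX /= mulrS.
Qed.

(** The multiplicity of the trivial character in [char t (- q) * genfun X t] is
    [class_count X q]; multiplying by [1 - t b] subtracts the same count at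
    [q - e_b], where [e_b] is the b-th unit vector, and cancels the rank. *)
Lemma laurent_backward_diffs S X q :
  laurent (fun t => \prod_(b <- S) (1 - t b) * (char t (fun a => - q a) * genfun X t))
    (backward_diffs S (class_count X) q) (if S is [::] then (size X)%:R else 0).
Proof.
elim: S q => [|b S IHS] q /=.
  by apply: laurent_ext (laurent_genfun X q) _ _ _ => // t _; rewrite big_nil mul1r.
apply: laurent_ext (laurentB (IHS q)
    (IHS (fun a => q a - (a == b)%:Z))) _ _ _ => [t tt||] /=.
- have -> : char t (fun a => - (q a - (a == b)%:Z)) = t b * char t (fun a => - q a).
    by rewrite char_delta.
  by rewrite big_cons; ring.
- by [].
- by rewrite subrr.
Qed.

End Laurent.

(** * Counting at the corners of an order ideal *)

(** The point [q - c(1,1,1,1)] lies in the orthant, on the face where the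
    coordinates in [S] vanish. *)
Definition corner (S : seq 'I_4) (c : nat) (q : 'I_4 -> int) : bool :=
  [forall a, if a \in S then q a == c%:Z else c%:Z <= q a].

(** The shifts at which an iterated difference evaluates its argument. *)
Definition cube (S : seq 'I_4) (e : 'I_4 -> int) : Prop :=
  forall a, 0 <= e a <= (a \in S)%:Z.

Lemma eq_backward_diffs S h h' q : uniq S ->
  (forall e, cube S e -> h (fun a => q a - e a) = h' (fun a => q a - e a)) ->
  backward_diffs S h q = backward_diffs S h' q.
Proof.
elim: S q => [|b S IHS] q /=.
  move=> _ hh'; have := hh' (fun=> 0) (fun=> isT).
  by have -> : (fun a => q a - 0) = q by apply/funext => a; rewrite subr0.
case/andP=> bS /IHS{}IHS hh'; rewrite /backward_diff; congr (_ - _); apply: IHS => e eS.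
  apply: hh' => a; rewrite in_cons; have /andP[-> /=] := eS a.
  by move=> /le_trans; apply; case: (a == b); case: (a \in S).
have -> : (fun a => q a - (a == b)%:Z - e a) = (fun a => q a - ((a == b)%:Z + e a)).
  by apply/funext => a; rewrite opprD addrA.
apply: hh' => a; rewrite in_cons; have := eS a.
by case: eqVneq => [->|_] /=; rewrite ?(negPf bS); lia.
Qed.

(** Differencing [c <= q b] in the direction [b] leaves [q b = c]. *)
Lemma backward_diff_corner b S c q : b \notin S ->
  backward_diff b (fun q => (corner S c q)%:R) q = (corner (b :: S) c q)%:R.
Proof.
move=> bS; rewrite /backward_diff.
have cornerE S' (q' : 'I_4 -> int) : b \notin S' -> corner S' c q' =
    (c%:Z <= q' b) && [forall (a | a != b), if a \in S' then q' a == c%:Z else c%:Z <= q' a].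
  move=> bS'; apply/forallP/andP => [H|[Hb /forallP H] a].
    split; first by have := H b; rewrite (negPf bS').
    by apply/forallP => a; apply/implyP => _; apply: H.
  have [->|ab] := eqVneq a b; first by rewrite (negPf bS').
  by have := H a; rewrite ab.
rewrite !(cornerE S) //= eqxx.
set A := [forall (a | a != b), _]; set B := [forall (a | a != b), _].
have -> : B = A.
  by apply: eq_forallb => a; case: eqVneq => //= _; rewrite subr0.
have -> : corner (b :: S) c q = (q b == c%:Z) && A.
  apply/forallP/andP => [H|[Hb /forallP H] a].
    split; first by have := H b; rewrite mem_head.
    apply/forallP => a; apply/implyP => ab; have := H a.
    by rewrite in_cons (negPf ab).
  rewrite in_cons; have [->//|ab] := eqVneq a b.
  by have := H a; rewrite ab.
by case: A; rewrite ?andbF // !andbT; lia.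
Qed.

Lemma backward_diffs_corner S c q : uniq S ->
  backward_diffs S (fun q => (corner [::] c q)%:R) q = (corner S c q)%:R.
Proof.
elim: S q => //= b S IHS q /andP[bS uS]; rewrite -backward_diff_corner // /backward_diff.
by rewrite !IHS.
Qed.

Lemma backward_diffs_sum (I : Type) (s : seq I) S (h : I -> ('I_4 -> int) -> int) q :
  backward_diffs S (fun q => \sum_(i <- s) h i q) q = \sum_(i <- s) backward_diffs S (h i) q.
Proof. by elim: S q => //= b S IHS q; rewrite /backward_diff !IHS sumrB. Qed.

(** A point of [X] in the class of [p] is [p - c(1,1,1,1)] for a single [c], and this
    [c] is in [C]; conversely a [c] in [C] yields a point as soon as the orthant
    contains [p - c(1,1,1,1)]. *)
Lemma class_count_line (X : seq (npoint 4)) (C : seq nat) p : uniq X -> uniq C ->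
  (forall (c : int) (x : npoint 4), (forall a, (x a)%:Z = p a - c) ->
     (x \in X) = (c \in map Posz C)) ->
  class_count X p = \sum_(c <- C) (corner [::] c p)%:R.
Proof.
move=> uX uC XC; rewrite /class_count.
pose on_line (x : npoint 4) (c : nat) := [forall a, (x a)%:Z == p a - c%:Z].
have -> : \sum_(x <- X) (trivial_weight (fun a => (x a)%:Z - p a))%:R =
          \sum_(x <- X) \sum_(c <- C) (on_line x c)%:R :> int.
  apply: eq_big_seq => x xX; have [dx|ndx] := boolP (trivial_weight _); last first.
    rewrite big1 // => c _; rewrite /on_line; case: forallP => // H; case/negP: ndx.
    by apply/forallP => a; rewrite (eqP (H a)) (eqP (H ord_max)); lia.
  have [c cE] : exists c, forall a, (x a)%:Z = p a - c.
    exists (p ord_max - (x ord_max)%:Z) => a; have /forallP/(_ a)/eqP /= := dx.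
    by lia.
  have := XC c x cE; rewrite xX => /esym/mapP[n nC cn].
  rewrite (bigD1_seq n) //= big1 ?addr0.
    by rewrite /on_line; case: forallP => // H; case: H => a; rewrite cE cn.
  move=> m mn; rewrite /on_line; case: forallP => // /(_ ord_max)/eqP; rewrite cE cn.
  by move/eqP: mn; lia.
rewrite exchange_big /=; apply: eq_big_seq => c cC; rewrite /corner /on_line.
case: forallP => /= [H|H]; last first.
  rewrite big1 // => x _; case: forallP => // H'; case: H => a.
  by have := H' a; move/eqP; lia.
(* the point of the line with parameter c *)
pose x : npoint 4 := [ffun a => absz (p a - c%:Z)].
have xE a : (x a)%:Z = p a - c%:Z by rewrite ffunE; have := H a; lia.
rewrite (bigD1_seq x) //=; last by rewrite (XC c) // map_f.
rewrite big1 ?addr0; first by case: forallP => // H'; case: H' => a; rewrite xE.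
move=> y yx; case: forallP => // H'; case/eqP: yx; apply/ffunP => a.
by apply/eqP; rewrite -eqz_nat xE; have := H' a.
Qed.

(** The lines through the corners of the cube at [q] all have to meet [X] in the
    parameters [c] in [C]; then each [c] contributes separately, and the differences
    only retain the [c] for which the corner lies on the boundary of the orthant. *)
Lemma backward_diffs_class_count (X : seq (npoint 4)) (C : seq nat) S q :
  uniq X -> uniq C -> uniq S ->
  (forall e, cube S e -> forall (c : int) (x : npoint 4),
     (forall a, (x a)%:Z = q a - e a - c) -> (x \in X) = (c \in map Posz C)) ->
  backward_diffs S (class_count X) q = \sum_(c <- C) (corner S c q)%:R.
Proof.
move=> uX uC uS H.
under eq_bigr do rewrite -backward_diffs_corner //.
rewrite -backward_diffs_sum; apply: eq_backward_diffs => // e eS.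
by apply: class_count_line => // c x; apply: H.
Qed.

(** * The shape of a solid partition with finite asymptotics *)

Lemma insert_coord_at a k p : insert_coord a k p a = k.
Proof. by rewrite ffunE unlift_none. Qed.

Lemma insert_coord_lift a k p j : insert_coord a k p (lift a j) = p j.
Proof. by rewrite ffunE liftK. Qed.

Lemma insert_coordK a k : cancel (insert_coord a k) (delete_coord a).
Proof. by move=> p; apply/ffunP => j; rewrite ffunE insert_coord_lift. Qed.

Lemma delete_coordK a (x : npoint 4) : insert_coord a (x a) (delete_coord a x) = x.
Proof.
apply/ffunP => c; case: (unliftP a c) => [j|] ->.
  by rewrite insert_coord_lift ffunE.
by rewrite insert_coord_at.
Qed.

Lemma finite_box N : finite_set (box N).
Proof.
apply: (@sub_finite_set _ _
  ((fun g : {ffun 'I_4 -> 'I_N.+1} => [ffun a => g a : nat]) @` setT)).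
  move=> x xN; exists [ffun a => inord (x a)] => //.
  by apply/ffunP => a; rewrite !ffunE inordK // ltnS.
by apply: finite_image; apply: finite_finset.
Qed.

Lemma mem_fset_set (T : choiceType) (A : set T) x :
  finite_set A -> (x \in fset_set A) = `[< A x >].
Proof. by move=> fA; rewrite in_fset_set // inE. Qed.

Section Shape.
Variable pi : set (npoint 4).
Hypotheses (sp : solid_partition pi) (fin : finite_asymptotics pi).

Lemma asymptotic_le a (p q : npoint 3) :
  asymptotic pi a q -> (forall j, (p j <= q j)%N) -> asymptotic pi a p.
Proof.
move=> Aq pq k; apply: sp (Aq k) _ => c; case: (unliftP a c) => [j|] ->.
  by rewrite !insert_coord_lift.
by rewrite !insert_coord_at.
Qed.

(** Beyond [K], the partition consists of the pairwise disjoint ends of its legs. *)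
Definition shape_bound (K : nat) : Prop :=
  (forall a p, asymptotic pi a p -> forall j, (p j < K)%N) /\
  (forall a x, pi x -> (K <= x a)%N -> asymptotic pi a (delete_coord a x)).

(** A bound for the ends is found without a chain condition on the slices
    [x_a = k]: a triple outside [lambda_a] dominates a triple outside [lambda_a] with
    entries at most [m], namely its truncation at [m], where [m] exceeds all entries
    of [lambda_a]; there are finitely many of these, and each leaves [pi] at some
    height. *)
Lemma shape_bound_exists : exists K, shape_bound K.
Proof.
pose m := (\max_a \max_(p <- fset_set (asymptotic pi a)) \max_j (p j))%N.+1.
have ltm a p : asymptotic pi a p -> forall j, (p j < m)%N.
  move=> Ap j; rewrite ltnS; apply: leq_trans (leq_bigmax a).
  have pA : p \in fset_set (asymptotic pi a) by rewrite mem_fset_set //; apply/asboolP.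
  by apply: leq_trans (leq_bigmax_seq p pA isT); apply: (leq_bigmax j).
(* [height a p] is a height at which the line over [p] has left [pi] *)
pose gap a (p : {ffun 'I_3 -> 'I_m.+1}) k :=
  ~ pi (insert_coord a k [ffun j => p j : nat]).
pose height a p := xget 0%N [set k | gap a p k].
exists (maxn m (\max_a \max_p height a p)%N); split=> [a p Ap j|a x pix].
  by rewrite leq_max (ltm a).
rewrite geq_max => /andP[_ hx].
apply: contrapT => nA.
pose p : {ffun 'I_3 -> 'I_m.+1} := [ffun j => inord (minn m (delete_coord a x j))].
have pE j : (p j : nat) = minn m (delete_coord a x j).
  by rewrite ffunE inordK // ltnS geq_minl.
have nAp : ~ asymptotic pi a [ffun j => p j : nat].
  have [lt|/existsNP[j /negP]] := pselect (forall j, (delete_coord a x j < m)%N).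
    suff -> : [ffun j => p j : nat] = delete_coord a x by [].
    apply/ffunP => j; rewrite ffunE pE; apply/minn_idPr.
    exact: ltnW.
  rewrite -leqNgt => mx /ltm/(_ j).
  by rewrite ffunE pE (minn_idPl mx) ltnn.
have [k kgap] : exists k, gap a p k by apply: contrapT => H; apply: nAp => k;
  apply: contrapT => H'; apply: H; exists k.
have hgap : gap a p (height a p).
  by rewrite /height; case: xgetP => [//|/(_ k)].
apply: hgap; apply: sp pix _ => c; case: (unliftP a c) => [j|] ->.
  rewrite insert_coord_lift ffunE pE; apply: leq_trans (geq_minr _ _) _.
  by rewrite ffunE.
rewrite insert_coord_at; apply: leq_trans hx.
apply: leq_trans (leq_bigmax a); exact: (leq_bigmax p).
Qed.

End Shape.

(** * Ends of the legs *)

Lemma stable_valueE (V : zmodType) (u : nat -> V) (K N : nat) :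
  (forall m, (K <= m)%N -> u m.+1 = u m) -> (K <= N)%N -> stable_value u = u N.
Proof.
move=> stepu KN.
have stab m : (K <= m)%N -> u m = u K.
  move/subnK <-; elim: (m - K)%N => //= d IHd.
  by rewrite addSn stepu ?leq_addl.
rewrite /stable_value; case: xgetP => [v _ [N0 H]|/(_ (u K))/= []].
  by rewrite -(H (maxn N0 K)) ?leq_maxl // !stab ?leq_maxr.
by exists K.
Qed.

Lemma count_sum (T : Type) (P : pred T) (s : seq T) :
  (count P s)%:Z = \sum_(x <- s) (P x)%:R.
Proof. by elim: s => [|x s IHs] /=; rewrite ?big_nil // big_cons -IHs PoszD; case: (P x). Qed.

Lemma ncardE (T : choiceType) (A : set T) (s : seq T) :
  uniq s -> (forall x, x \in s <-> A x) -> ncard A = size s.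
Proof.
move=> us sA; have fA : finite_set A.
  by apply/finite_seqP; exists s; apply/seteqP; split=> x /sA.
rewrite /ncard; apply/perm_size/uniq_perm => //.
by move=> x; rewrite mem_fset_set //; apply/asboolP/idP => /sA.
Qed.

Section Ends.
Variable pi : set (npoint 4).
Hypotheses (sp : solid_partition pi) (fin : finite_asymptotics pi).

Definition boxed (N : nat) : seq (npoint 4) := fset_set (pi `&` box N).
Definition profile (a : 'I_4) : seq (npoint 3) := fset_set (asymptotic pi a).

Lemma boxed_uniq N : uniq (boxed N). Proof. exact: fset_uniq. Qed.
Lemma profile_uniq a : uniq (profile a). Proof. exact: fset_uniq. Qed.

Lemma mem_boxed N x : reflect (pi x /\ box N x) (x \in boxed N).
Proof.
rewrite /boxed mem_fset_set; first exact: asboolP.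
exact: finite_setIr (finite_box N).
Qed.

Lemma mem_profile a p : reflect (asymptotic pi a p) (p \in profile a).
Proof. by rewrite /profile mem_fset_set //; exact: asboolP. Qed.

Variable K : nat.
Hypothesis bK : shape_bound pi K.

(** The boxes of [pi] in the outer shell of a large box are the new boxes of the legs,
    and each belongs to one leg only. *)
Lemma sum_boxedS (V : zmodType) (phi : npoint 4 -> V) N : (K <= N)%N ->
  \sum_(x <- boxed N.+1) phi x =
  \sum_(x <- boxed N) phi x
  + \sum_a \sum_(y <- profile a) phi (insert_coord a N.+1 y).
Proof.
case: bK => ltK endK KN.
rewrite (bigID (fun x => x \in boxed N)) /=; congr (_ + _).
  rewrite -big_filter; apply: perm_big; apply: uniq_perm.
  - exact/filter_uniq/boxed_uniq.
  - exact: boxed_uniq.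
  move=> x; rewrite mem_filter andb_idr // => /mem_boxed[pix xN].
  by apply/mem_boxed; split=> // a; apply/leqW/xN.
have end_at a y : y \in profile a -> forall b, b != a ->
    (insert_coord a N.+1 y b < N.+1)%N.
  move=> /mem_profile ya b; case: (unliftP a b) => [j|] ->; last by rewrite eqxx.
  by rewrite insert_coord_lift => _; rewrite ltnS (leq_trans _ KN) // ltnW // (ltK a).
have -> : \sum_a \sum_(y <- profile a) phi (insert_coord a N.+1 y) =
    \sum_a \sum_(x <- boxed N.+1 | x a == N.+1) phi x.
  apply: eq_bigr => a _; rewrite -(big_map (insert_coord a N.+1) xpredT phi) -[RHS]big_filter.
  apply: perm_big; apply: uniq_perm.
  - by rewrite map_inj_uniq ?profile_uniq //; apply: can_inj (insert_coordK _ _).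
  - exact/filter_uniq/boxed_uniq.
  move=> x; rewrite mem_filter; apply/mapP/andP => [[y ya ->]|[/eqP xa /mem_boxed[pix xN]]].
    rewrite insert_coord_at eqxx; split=> //; apply/mem_boxed; split.
      by move/mem_profile: ya.
    move=> b; have [->|ba] := eqVneq b a; first by rewrite insert_coord_at.
    exact/ltnW/end_at.
  exists (delete_coord a x); last by rewrite -xa delete_coordK.
  by apply/mem_profile/endK => //; rewrite xa ltnW // ltnS.
under [RHS]eq_bigr do rewrite big_mkcond.
rewrite exchange_big big_mkcond /=; apply: eq_big_seq => x /mem_boxed[pix xN].
rewrite -big_mkcond /=; case: ifPn => [xnN|].
  have [a xa] : exists a, x a = N.+1.
    apply: contrapT => H; case/mem_boxed: xnN; split=> // a.
    have := xN a; rewrite leq_eqVlt => /orP[/eqP xa|//]; case: H; by exists a.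
  rewrite (big_pred1 a) // => b /=; apply/eqP/eqP => [xb|-> //].
  apply: contrapT => /eqP ba.
  have ya : delete_coord a x \in profile a.
    by apply/mem_profile/endK => //; rewrite xa ltnW // ltnS.
  by have := end_at _ _ ya b ba; rewrite -xa delete_coordK xb xa ltnn.
rewrite negbK => /mem_boxed[_ xN']; rewrite big_pred0 // => a.
by apply/negbTE; rewrite neq_ltn ltnS xN'.
Qed.

(** This one statement, for different [phi], makes [sigma] and the rational function
    [Z_pi] independent of the large box used to compute them. *)
Lemma renormalized_sumS (V : zmodType) (phi : npoint 4 -> V) N : (K <= N)%N ->
  let S N := \sum_(x <- boxed N) phi x
      - \sum_a \sum_(y <- profile a) \sum_(n < N.+1) phi (insert_coord a n y) in
  S N.+1 = S N.
Proof.
move=> KN /=; rewrite sum_boxedS //.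
have -> : \sum_a \sum_(y <- profile a) \sum_(n < N.+2) phi (insert_coord a n y) =
  \sum_a \sum_(y <- profile a) \sum_(n < N.+1) phi (insert_coord a n y)
  + \sum_a \sum_(y <- profile a) phi (insert_coord a N.+1 y).
  rewrite -big_split; apply: eq_bigr => a _; rewrite -big_split; apply: eq_bigr => y _.
  by rewrite big_ord_recr.
by rewrite opprD addrACA subrr addr0.
Qed.

Lemma ncard_leg a N (D : set (npoint 4)) : (K <= N)%N ->
  (ncard (leg pi a `&` box N `&` D))%:Z =
  \sum_(y <- profile a) \sum_(n < N.+1) (`[< D (insert_coord a n y) >])%:R.
Proof.
move=> KN; case: bK => ltK _.
pose s := [seq x <- [seq insert_coord a n y | y <- profile a, n <- index_iota 0 N.+1] | `[< D x >]].
rewrite (@ncardE _ _ s).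
- rewrite size_filter count_sum big_allpairs_dep; apply: eq_bigr => y _.
  by rewrite big_mkord.
- apply: filter_uniq; apply: allpairs_uniq; rewrite ?profile_uniq ?iota_uniq //=.
  move=> [y n] [y' n'] /= _ _ e; congr pair.
    by rewrite -(insert_coordK a n y) e insert_coordK.
  by rewrite -(insert_coord_at a n y) e insert_coord_at.
move=> x; rewrite mem_filter; split.
  case/andP=> /asboolP Dx /allpairsP[[y n] /= [ya nN xE]]; subst x.
  split=> //; split; first by rewrite /leg /= insert_coordK; apply/mem_profile.
  move=> b; case: (unliftP a b) => [j|] ->.
    by rewrite insert_coord_lift (leq_trans _ KN) // ltnW // (ltK a) //; apply/mem_profile.
  by rewrite insert_coord_at; move: nN; rewrite mem_index_iota.
move=> [[lx xN] Dx]; apply/andP; split; first exact/asboolP.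
apply/allpairsP; exists (delete_coord a x, x a); split=> /=.
- exact/mem_profile.
- by rewrite mem_index_iota ltnS xN.
- by rewrite delete_coordK.
Qed.

Lemma ncard_boxed N (D : set (npoint 4)) :
  (ncard (pi `&` box N `&` D))%:Z = \sum_(x <- boxed N) (`[< D x >])%:R.
Proof.
rewrite (@ncardE _ _ [seq x <- boxed N | `[< D x >]]).
- by rewrite size_filter count_sum.
- exact/filter_uniq/boxed_uniq.
move=> x; rewrite mem_filter; split; first by case/andP=> /asboolP Dx /mem_boxed.
by case=> /mem_boxed -> Dx; rewrite andbT; apply/asboolP.
Qed.

Lemma sigmaE i N : (K <= N)%N ->
  sigma i pi = renormalized_volume pi
    + (\sum_(x <- boxed N) (`[< dominant_diagonal i x >])%:R
       - \sum_a \sum_(y <- profile a) \sum_(n < N.+1)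
           (`[< dominant_diagonal i (insert_coord a n y) >])%:R).
Proof.
move=> KN; rewrite /sigma; congr (_ + _).
have E m : (K <= m)%N ->
  (ncard (pi `&` box m `&` dominant_diagonal i))%:Z
      - \sum_(b < 4) (ncard (leg pi b `&` box m `&` dominant_diagonal i))%:Z =
  \sum_(x <- boxed m) (`[< dominant_diagonal i x >])%:R
       - \sum_a \sum_(y <- profile a) \sum_(n < m.+1)
           (`[< dominant_diagonal i (insert_coord a n y) >])%:R.
  by move=> Km; rewrite ncard_boxed; congr (_ - _); apply: eq_bigr => a _; rewrite ncard_leg.
rewrite (@stable_valueE _ _ K N) // ?E // => m Km.
by rewrite !E ?leqW // (renormalized_sumS (fun x => (`[< dominant_diagonal i x >])%:R)).
Qed.

Lemma ZnorE (F : fieldType) N (t : 'I_4 -> F) : Znor pi N t = genfun (boxed N) t.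
Proof. by rewrite /Znor fsbig_finite //; exact: finite_setIr (finite_box N). Qed.

Lemma ZasymE (F : fieldType) a (t : 'I_4 -> F) :
  Zasym pi a t = \sum_(p <- profile a) \prod_(j < 3) t (lift a j) ^+ p j.
Proof. by rewrite /Zasym fsbig_finite. Qed.

Lemma insert_coord_mono (F : fieldType) a n p (t : 'I_4 -> F) :
  \prod_b t b ^+ insert_coord a n p b = t a ^+ n * \prod_(j < 3) t (lift a j) ^+ p j.
Proof.
rewrite (bigD1_ord a) //= insert_coord_at; congr (_ * _).
by apply: eq_bigr => j _; rewrite insert_coord_lift.
Qed.

Lemma genfun_insert (F : fieldType) a n (t : 'I_4 -> F) :
  genfun [seq insert_coord a n y | y <- profile a] t = t a ^+ n * Zasym pi a t.
Proof.
rewrite ZasymE mulr_sumr /genfun big_map; apply: eq_bigr => p _.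
exact: insert_coord_mono.
Qed.

Lemma ZpiE (F : fieldType) N (t : 'I_4 -> F) : (forall a, t a != 1) -> (K <= N)%N ->
  Zpi pi t = Znor pi N t + \sum_a Zasym pi a t / (1 - t a) * t a ^+ N.+1.
Proof.
move=> t1; apply: (@stable_valueE _ _ K) => m Km.
rewrite !ZnorE /genfun sum_boxedS // -!addrA; congr (_ + _).
rewrite -big_split; apply: eq_bigr => a _ /=.
have -> : \sum_(y <- profile a) \prod_b t b ^+ insert_coord a m.+1 y b =
  t a ^+ m.+1 * Zasym pi a t by rewrite -genfun_insert /genfun big_map.
have : 1 - t a != 0 by rewrite subr_eq0 eq_sym.
by rewrite [t a ^+ m.+2]exprS => ta; field.
Qed.

End Ends.

(** * Order ideals *)

Lemma four_indices (s : seq 'I_4) : uniq s -> size s = 4 -> perm_eq (index_enum 'I_4) s.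
Proof.
move=> us s4; apply: uniq_perm; rewrite ?index_enum_uniq // => a.
rewrite mem_index_enum; symmetry.
have sub : {subset s <= index_enum 'I_4} by move=> b _; rewrite mem_index_enum.
have le : (size (index_enum 'I_4) <= size s)%N.
  by rewrite s4 -[X in (_ <= X)%N](card_ord 4) cardE enumT.
by have [_ ->] := uniq_min_size us sub le; rewrite mem_index_enum.
Qed.

Lemma complete_four (i j : 'I_4) : i != j -> exists k l, uniq [:: i; j; k; l].
Proof.
case: (unliftP i j) => [j'|] ->; last by rewrite eqxx.
move=> _; exists (lift i (lift j' (0 : 'I_2))), (lift i (lift j' (1 : 'I_2))).
by rewrite /= !inE !(inj_eq lift_inj) !(negPf (neq_lift _ _)) /=.
Qed.

Lemma forall_four (i j k l : 'I_4) (P : pred 'I_4) : uniq [:: i; j; k; l] ->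
  [forall a, P a] = [&& P i, P j, P k & P l].
Proof.
move=> u; have pE := four_indices u erefl.
apply/forallP/and4P => [H|[Pi Pj Pk Pl] a]; first by split.
have := mem_index_enum a; rewrite (perm_mem pE) !inE.
by case/or4P=> /eqP ->.
Qed.

Lemma big_compl (R : Type) (idx : R) (op : Monoid.com_law idx)
    (i j k l : 'I_4) (f : 'I_4 -> R) : uniq [:: i; j; k; l] ->
  \big[op/idx]_(a | a != i) f a = op (f j) (op (f k) (f l)).
Proof.
move=> u; have pE := four_indices u erefl; rewrite (perm_big _ pE) /=.
move: u; rewrite /= !inE !negb_or => /and4P[/and3P[ij ik il] _ _ _].
by rewrite !big_cons big_nil eqxx !(eq_sym _ i) ij ik il Monoid.mulm1.
Qed.

Lemma big_four (R : Type) (idx : R) (op : Monoid.com_law idx)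
    (i j k l : 'I_4) (f : 'I_4 -> R) : uniq [:: i; j; k; l] ->
  \big[op/idx]_a f a = op (f i) (op (f j) (op (f k) (f l))).
Proof. by move=> u; rewrite (bigD1 i) //= (big_compl _ _ u). Qed.

Definition weight (x : npoint 4) : 'I_4 -> int := fun a => (x a)%:Z.

Definition order_ideal (X : seq (npoint 4)) : Prop :=
  forall x y : npoint 4, y \in X -> (forall a, (x a <= y a)%N) -> x \in X.

(** A box of maximal degree can be removed from a finite order ideal. *)
Lemma order_ideal_ind (P : seq (npoint 4) -> Prop) :
  (forall X Y, perm_eq X Y -> P X -> P Y) ->
  P [::] ->
  (forall mu X, mu \notin X -> uniq X -> order_ideal X -> order_ideal (mu :: X) ->
     P X -> P (mu :: X)) ->
  forall X, uniq X -> order_ideal X -> P X.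
Proof.
move=> Pperm P0 PS X; have [n] := ubnP (size X).
elim: n X => // n IHn X; rewrite ltnS => sX uX iX.
have [->//|X0] := eqVneq X [::].
pose d (x : npoint 4) := (\sum_a x a)%N.
have [mu muX mumax] : exists2 mu, mu \in X & forall x, x \in X -> (d x <= d mu)%N.
  case: X X0 {IHn sX uX iX} => // x0 X _.
  elim: X x0 => [|x X IHX] x0.
    by exists x0; rewrite ?mem_head // => x; rewrite inE => /eqP ->.
  have [mu muX mumax] := IHX x.
  have [le|lt] := leqP (d x0) (d mu).
    exists mu; first by rewrite in_cons muX orbT.
    by move=> y; rewrite in_cons => /predU1P[->|/mumax].
  exists x0; first exact: mem_head.
  move=> y; rewrite in_cons => /predU1P[->//|/mumax] /leq_trans; apply; exact: ltnW.
have pX : perm_eq X (mu :: rem mu X) by exact: perm_to_rem.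
have u' : uniq (rem mu X) by exact: rem_uniq.
have nmu : mu \notin rem mu X by rewrite mem_rem_uniq // !inE eqxx.
have irem : order_ideal (rem mu X).
  move=> x y; rewrite !mem_rem_uniq // !inE => /andP[ymu yX] xy.
  rewrite (iX _ _ yX xy) andbT; apply/eqP => xmu; subst x.
  case/eqP: ymu; apply/ffunP => a; apply/eqP; rewrite eqn_leq xy andbT.
  have := mumax _ yX; rewrite /d (bigD1 a) //= [in X in (_ <= X)%N](bigD1 a) //=.
  have : (\sum_(b | b != a) mu b <= \sum_(b | b != a) y b)%N by apply: leq_sum.
  move=> h1 h2; rewrite -(leq_add2r (\sum_(b | b != a) y b)); apply: leq_trans h2 _; by rewrite leq_add2l.
apply: (Pperm (mu :: rem mu X)); first by rewrite perm_sym.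
apply: PS => //.
  by move=> x y; rewrite -!(perm_mem pX); apply: iX.
apply: IHn => //; rewrite size_rem // (leq_trans _ sX) // prednK //.
by case: (X) X0.
Qed.

Section Corners.
Variable F : fieldType.
Implicit Types (t : 'I_4 -> F).

Lemma genfun_perm X Y t : perm_eq X Y -> genfun X t = genfun Y t.
Proof. exact: perm_big. Qed.

Lemma genfun_cons mu X t : genfun (mu :: X) t = char t (weight mu) + genfun X t.
Proof. by rewrite /genfun big_cons. Qed.

Lemma char_inv t q : char (fun a => (t a)^-1) q = char t (fun a => - q a).
Proof. by apply: eq_bigr => a _; rewrite exprz_inv. Qed.

Lemma laurent_corners S X C q : S != [::] -> uniq X -> uniq C -> uniq S ->
  (forall e, cube S e -> forall (c : int) (x : npoint 4),
     (forall a, (x a)%:Z = q a - e a - c) -> (x \in X) = (c \in map Posz C)) ->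
  laurent (fun t => \prod_(b <- S) (1 - t b) * (char t (fun a => - q a) * genfun X t))
    (\sum_(c <- C) (corner S c q)%:R) 0.
Proof.
move=> S0 uX uC uS H; apply: laurent_ext (laurent_backward_diffs F S X q) _ _ _ => //.
  by rewrite (backward_diffs_class_count (C := C)).
by case: S S0 {uS H}.
Qed.

Lemma sum_corner b S K q :
  \sum_(c <- iota 0 K) (corner (b :: S) c q)%:R =
  ((0 <= q b < K%:Z) && corner (b :: S) `|q b|%N q)%:R :> int.
Proof.
have [/andP[q0 qK]|H] /= := boolP (_ <= _ < _); last first.
  rewrite big1_seq // => c; rewrite mem_iota /= add0n => cK.
  case: (boolP (corner _ _ _)) => // /forallP/(_ b); rewrite mem_head => /eqP qb.
  by case/negP: H; rewrite qb ltz_nat.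
have qbE : `|q b|%N = q b :> int by lia.
rewrite (bigD1_seq `|q b|%N) ?iota_uniq ?mem_iota //=; last by lia.
rewrite big1 ?addr0 // => c /eqP cq.
case: (boolP (corner _ _ _)) => // /forallP/(_ b); rewrite mem_head => /eqP.
by lia.
Qed.

Lemma mem_posz_iota (c : int) K : (c \in map Posz (iota 0 K)) = (0 <= c < K%:Z).
Proof.
apply/mapP/idP => [[n]|H].
  by rewrite mem_iota => /andP[_ nK] ->; rewrite ltz_nat.
by exists `|c|%N; rewrite ?mem_iota; lia.
Qed.

(** A box [mu] is added to an order ideal [X], and [q] is close enough to [mu] from
    below that all corners of the cube at [q] are at most [mu] and at least
    [mu - (1,1,1,1)].  Going down the line from such a corner one stays in [mu :: X];
    going up one dominates [mu].  The coordinate [a] or [b] outside [S] excludes the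
    one ambiguous point, [mu] itself. *)
Section Step.
Variables (mu : npoint 4) (X : seq (npoint 4)).
Hypotheses (nmu : mu \notin X) (uX : uniq X).
Hypotheses (iX : order_ideal X) (imuX : order_ideal (mu :: X)).
Variables (S : seq 'I_4) (q : 'I_4 -> int).
Hypotheses (S0 : S != [::]) (uS : uniq S).
Hypothesis qmu : forall b, (mu b)%:Z - 1 + (b \in S)%:Z <= q b <= (mu b)%:Z.

Lemma laurent_corners_new a K : a \notin S -> q a = (mu a)%:Z -> (mu a < K)%N ->
  laurent (fun t => \prod_(b <- S) (1 - t b) *
                    (char t (fun a => - q a) * genfun (mu :: X) t))
    (\sum_(c <- iota 0 K) (corner S c q)%:R) 0.
Proof.
move=> aS qa aK; apply: laurent_corners; rewrite ?iota_uniq //= ?nmu //.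
move=> e eS c x xE; rewrite mem_posz_iota.
have ea : e a = 0 by have := eS a; rewrite (negPf aS); lia.
apply/idP/idP => [xX|/andP[c0 _]]; last first.
  apply: (imuX (mem_head mu X)) => b.
  by have := eS b; have := qmu b; have := xE b; case: (b \in S); lia.
suff : 0 <= c by have := xE a; lia.
rewrite leNgt; apply/negP => c0.
have mux b : (mu b <= x b)%N.
  by have := eS b; have := qmu b; have := xE b; case: (b \in S); lia.
move: xX; rewrite in_cons => /predU1P[xmu|xX].
  by have := xE a; rewrite xmu qa ea; lia.
by case/negP: nmu; apply: iX xX _.
Qed.

Lemma laurent_corners_old b K : b \notin S -> q b = (mu b)%:Z - 1 -> (mu b < K)%N ->
  laurent (fun t => \prod_(b <- S) (1 - t b) *
                    (char t (fun a => - q a) * genfun X t))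
    (\sum_(c <- iota 0 K) (corner S c q)%:R) 0.
Proof.
move=> bS qb bK; apply: laurent_corners; rewrite ?iota_uniq //=.
move=> e eS c x xE; rewrite mem_posz_iota.
have eb : e b = 0 by have := eS b; rewrite (negPf bS); lia.
apply/idP/idP => [xX|/andP[c0 _]]; last first.
  have : x \in mu :: X.
    apply: (imuX (mem_head mu X)) => a.
    by have := eS a; have := qmu a; have := xE a; case: (a \in S); lia.
  rewrite in_cons => /predU1P[xmu|//].
  by have := xE b; rewrite xmu qb eb; lia.
suff : 0 <= c by have := xE b; lia.
rewrite leNgt; apply/negP => c0.
case/negP: nmu; apply: iX xX _ => a.
by have := eS a; have := qmu a; have := xE a; case: (a \in S); lia.
Qed.

End Step.

(** Adding [mu] to [X] changes the product by [t^-mu] times the generating function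
    of [X] plus [t^mu] times the dual of that of [mu :: X]; the second summand is the
    dual of a term of the same kind as the first. *)
Lemma laurent_selfproduct (Q : pred (npoint 4)) (A : ('I_4 -> F) -> F) (u v : npoint 4 -> int) :
  (forall mu X, mu \notin X -> uniq X -> order_ideal X -> order_ideal (mu :: X) ->
     all Q (mu :: X) ->
     laurent (fun t => A t * (char t (fun a => - weight mu a) * genfun X t)) (u mu) 0 /\
     laurent (fun t => dual A t * (char t (fun a => - weight mu a) * genfun (mu :: X) t))
       (v mu) 0) ->
  forall X, uniq X -> order_ideal X -> all Q X ->
  laurent (fun t => A t * genfun X t * dual (genfun X) t) (\sum_(x <- X) (u x + v x)) 0.
Proof.
move=> H; apply: order_ideal_ind => [X Y XY IH|_|mu X nmu uX iX imuX IH QX].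
- rewrite -(perm_all _ XY) => /IH lX; apply: laurent_ext lX _ _ _ => [t tt||//].
    by rewrite /dual !(genfun_perm _ XY).
  by rewrite (perm_big _ XY).
- apply: laurent_ext (laurent0 F) _ _ _ => [t tt||//]; last by rewrite big_nil.
  by rewrite /genfun big_nil mulr0 mul0r.
have [lu lv] := H mu X nmu uX iX imuX QX.
have lX : laurent (fun t => A t * genfun X t * dual (genfun X) t) (\sum_(x <- X) (u x + v x)) 0.
  by apply: IH; case/andP: QX.
apply: laurent_ext (laurentD (laurentD lu (laurent_dual lv)) lX) _ _ _.
- move=> t tt; have invK : (fun a => ((t a)^-1)^-1) = t.
    by apply/funext => a; rewrite invrK.
  have oppK : (fun a => - - weight mu a) = weight mu by apply/funext => a; rewrite opprK.
  by rewrite /dual /= invK !genfun_cons !char_inv oppK; ring.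
- by rewrite big_cons.
- by rewrite !addr0.
Qed.

(** A box [p] at the height [N] of the bounding box: below it all boxes belong to [X],
    and above it none does. *)
Lemma laurent_end S X (p : npoint 4) a N : S != [::] -> uniq S -> a \notin S ->
  uniq X -> order_ideal X -> p \in X -> p a = N -> (forall x : npoint 4, x \in X -> (x a <= N)%N) ->
  laurent (fun t => \prod_(b <- S) (1 - t b) * (char t (fun a => - weight p a) * genfun X t))
    (\sum_(c <- iota 0 N.+1) (corner S c (weight p))%:R) 0.
Proof.
move=> S0 uS aS uX iX pX pa XN; apply: laurent_corners; rewrite ?iota_uniq //.
move=> e eS c x xE; rewrite mem_posz_iota.
have ea : e a = 0 by have := eS a; rewrite (negPf aS); lia.
have xa := xE a; rewrite /weight pa ea in xa.
apply/idP/andP => [/XN xN|[c0 _]]; first by split; lia.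
apply: iX pX _ => b; have := xE b; have := eS b; rewrite /weight.
by lia.
Qed.

(** The coordinate [a] exceeds the coordinate [b] on [X] but not at [q], and the shifts
    in the directions [S] do not affect them; so no line through a corner of the cube
    meets [X]. *)
Lemma laurent_cross S X q a b : S != [::] -> uniq S -> a \notin S -> b \notin S ->
  uniq X -> (forall x : npoint 4, x \in X -> (x b < x a)%N) -> q a <= q b ->
  laurent (fun t => \prod_(b <- S) (1 - t b) * (char t (fun a => - q a) * genfun X t)) 0 0.
Proof.
move=> S0 uS aS bS uX Xab qab.
apply: laurent_ext (@laurent_corners S X [::] q S0 uX isT uS _) _ _ _ => //.
  move=> e eS c x xE; rewrite in_nil; apply/negbTE/negP => /Xab.
  have ea : e a = 0 by have := eS a; rewrite (negPf aS); lia.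
  have eb : e b = 0 by have := eS b; rewrite (negPf bS); lia.
  by have := xE a; have := xE b; rewrite ea eb; lia.
by rewrite big_nil.
Qed.

Lemma char_delta_exp t b (n : int) q : torus_point t ->
  t b ^ n * char t (fun a => - q a) = char t (fun a => - (q a - (a == b)%:Z * n)).
Proof.
move=> tt; rewrite -[t b ^ n](_ : char t (fun a => (a == b)%:Z * n) = _) -?charD //.
  by congr char; apply/funext => a; rewrite opprB.
rewrite /char (bigD1 b) //= eqxx mul1r big1 ?mulr1 // => a /negPf ->.
by rewrite mul0r expr0z.
Qed.

End Corners.

(** * Products of an order ideal with its dual *)

Lemma four_neq (i j k l : 'I_4) : uniq [:: i; j; k; l] ->
  ((i == j = false) * (i == k = false) * (i == l = false)) *
  ((j == i = false) * (j == k = false) * (j == l = false)) *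
  ((k == i = false) * (k == j = false) * (k == l = false)) *
  ((l == i = false) * (l == j = false) * (l == k = false)).
Proof.
rewrite /= !inE !negb_or => /and4P[/and3P[ij ik il] /andP[jk jl] kl _].
by do !split; apply/negbTE; rewrite // eq_sym.
Qed.

Section Products.
Variable F : fieldType.
Implicit Types (t : 'I_4 -> F).
Variables (i j k l : 'I_4).
Hypothesis u : uniq [:: i; j; k; l].

Definition Pcompl (i : 'I_4) (t : 'I_4 -> F) : F := Pfun (~: [set i]) t.

Lemma PcomplE t : Pcompl i t = (1 - t j) * ((1 - t k) * (1 - t l)).
Proof.
rewrite /Pcompl /Pfun -(big_compl _ (fun a => 1 - t a) u).
by apply: eq_bigl => a; rewrite !inE.
Qed.

Lemma Pfun2E t : Pfun (~: [set i; j]) t = (1 - t k) * (1 - t l).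
Proof.
rewrite /Pfun.
have -> : \prod_(a in ~: [set i; j]) (1 - t a) =
   \prod_(a | a != i) (if a == j then 1 else 1 - t a).
  rewrite [RHS](bigD1 j) ?(four_neq u) //= eqxx mul1r.
  rewrite big_mkcond [RHS]big_mkcond; apply: eq_bigr => a _; rewrite !inE negb_or.
  by case: (a == i) => //=; case: (a == j).
by rewrite (big_compl _ _ u) eqxx !(four_neq u) /= mul1r.
Qed.

Lemma torusE t : torus_point t -> t i = (t j * (t k * t l))^-1.
Proof.
case=> t0 _; rewrite (big_four _ _ u) /= => tp.
by rewrite -[LHS]mulr1 -[X in _ * X](mulfV (_ : t j * (t k * t l) != 0)) ?mulf_neq0 // mulrA tp mul1r.
Qed.

Lemma dual_PcomplE t : torus_point t -> dual (Pcompl i) t = - (t i * Pcompl i t).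
Proof.
move=> tt; rewrite /dual !PcomplE (torusE tt); case: tt => t0 _ _.
by field; rewrite !t0.
Qed.

Lemma corner4 S c q : corner S c q =
  [&& if i \in S then q i == c%:Z else c%:Z <= q i,
      if j \in S then q j == c%:Z else c%:Z <= q j,
      if k \in S then q k == c%:Z else c%:Z <= q k &
      if l \in S then q l == c%:Z else c%:Z <= q l].
Proof. exact: (forall_four _ u). Qed.

Lemma trivial_weight4 q : trivial_weight q = [&& q i == q j, q i == q k & q i == q l].
Proof.
apply/forallP/and3P => [H|[/eqP ij /eqP ik /eqP il] a].
  by split; rewrite (eqP (H i)) eq_sym.
suff q_a b : q b = q i by rewrite !q_a.
have := mem_index_enum b; rewrite (perm_mem (four_indices u erefl)) !inE.
by case/or4P=> /eqP ->.
Qed.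

Lemma ujkl : uniq [:: j; k; l]. Proof. by case/andP: u. Qed.

Lemma four_cases b : [\/ b = i, b = j, b = k | b = l].
Proof.
have := mem_index_enum b; rewrite (perm_mem (four_indices u erefl)) !inE.
by case/or4P=> /eqP ->; [apply: Or41|apply: Or42|apply: Or43|apply: Or44].
Qed.

(** Adding [mu] contributes [mu_j = mu_k = mu_l <= mu_i] with sign +1 and
    [mu_j = mu_k = mu_l < mu_i] with sign -1; the equality of all four coordinates
    is left. *)
Lemma laurent_square X : uniq X -> order_ideal X ->
  laurent (fun t => dual (Pcompl i) t * genfun X t * dual (genfun X) t)
    (\sum_(x <- X) (trivial_weight (weight x))%:R) 0.
Proof.
move=> uX iX.
pose U (x : npoint 4) : int := - [&& x j == x k, x j == x l & (x j < x i)%N]%:R.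
pose V (x : npoint 4) : int := [&& x j == x k, x j == x l & (x j <= x i)%N]%:R.
have L := @laurent_selfproduct F predT (dual (Pcompl i)) U V.
apply: laurent_ext (L _ X uX iX (all_predT X)) _ _ _ => //.
  move=> {uX iX L}mu {}X nmu uX iX imuX _; split.
    have := @laurent_corners_old F mu X nmu uX iX imuX [:: j; k; l]
      (fun a => weight mu a - (a == i)%:Z) isT ujkl _ i (mu i).+1.
    move=> H; apply: laurent_ext (laurentN (H _ _ _ _)) _ _ _ => {H}.
    - by move=> b; rewrite /weight; case: (four_cases b) => ->; rewrite !inE !(four_neq u) ?eqxx /=; lia.
    - by rewrite !inE !(four_neq u).
    - by rewrite eqxx.
    - by [].
    - move=> t tt; rewrite dual_PcomplE // -char_delta // PcomplE !big_cons big_nil.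
      by ring.
    - rewrite sum_corner corner4 !inE !(four_neq u) ?eqxx /= /U /weight; congr (- _%:R).
      by lia.
    - by rewrite oppr0.
  have := @laurent_corners_new F mu X nmu uX iX imuX [:: j; k; l]
      (weight mu) isT ujkl _ i (mu i).+1.
  move=> H; apply: laurent_ext (H _ _ _ _) _ _ _ => {H}.
  - by move=> b; rewrite /weight; case: (b \in _); lia.
  - by rewrite !inE !(four_neq u).
  - by [].
  - by [].
  - move=> t tt; rewrite dualK PcomplE !big_cons big_nil.
    by ring.
  - rewrite sum_corner corner4 !inE !(four_neq u) ?eqxx /= /V /weight; congr (_%:R).
    by lia.
  - by [].
apply: eq_bigr => x _; rewrite trivial_weight4 /U /V /weight.
by lia.
Qed.

Lemma dual_half_factor t : torus_point t ->
  dual (fun t => t j * ((1 - t k) * (1 - t l))) t = t i * ((1 - t k) * (1 - t l)).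
Proof.
move=> tt; rewrite /dual (torusE tt); case: tt => t0 _ _.
by field; rewrite !t0.
Qed.

(** The factor [t_j (1 - t_k) (1 - t_l)] minus its dual is the difference of the duals
    of [P_jkl] and [P_ikl]. *)
Lemma laurent_half_square X : uniq X -> order_ideal X ->
  laurent (fun t => t j * ((1 - t k) * (1 - t l)) * genfun X t * dual (genfun X) t)
    (\sum_(x <- X) ([&& x k == x l, (x k <= x i)%N & (x k < x j)%N]%:R
                    + [&& x k == x l, (x k <= x j)%N & (x k < x i)%N]%:R)) 0.
Proof.
pose R t := t j * ((1 - t k) * (1 - t l)); rewrite -/(R _) => uX iX.
apply: (@laurent_selfproduct F predT R
  (fun x => [&& x k == x l, (x k <= x i)%N & (x k < x j)%N]%:R)
  (fun x => [&& x k == x l, (x k <= x j)%N & (x k < x i)%N]%:R)) => //; last exact/allP.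
move=> {uX iX}mu {}X nmu uX iX imuX _.
have ukl : uniq [:: k; l] by rewrite /= inE (four_neq u).
split.
  have := @laurent_corners_old F mu X nmu uX iX imuX [:: k; l]
    (fun a => weight mu a - (a == j)%:Z) isT ukl _ j (mu j).+1.
  move=> H; apply: laurent_ext (H _ _ _ _) _ _ _ => {H}.
  - by move=> b; rewrite /weight; case: (four_cases b) => ->; rewrite !inE !(four_neq u) ?eqxx /=; lia.
  - by rewrite !inE !(four_neq u).
  - by rewrite eqxx.
  - by [].
  - by move=> t tt; rewrite /R -char_delta // !big_cons big_nil; ring.
  - rewrite sum_corner corner4 !inE !(four_neq u) ?eqxx /= /weight; congr (_%:R).
    by lia.
  - by [].
have := @laurent_corners_new F mu X nmu uX iX imuX [:: k; l]
    (fun a => weight mu a - (a == i)%:Z) isT ukl _ j (mu j).+1.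
move=> H; apply: laurent_ext (H _ _ _ _) _ _ _ => {H}.
- by move=> b; rewrite /weight; case: (four_cases b) => ->; rewrite !inE !(four_neq u) ?eqxx /=; lia.
- by rewrite !inE !(four_neq u).
- by rewrite !(four_neq u) subr0.
- by [].
- by move=> t tt; rewrite /R dual_half_factor // -char_delta // !big_cons big_nil; ring.
- rewrite sum_corner corner4 !inE !(four_neq u) ?eqxx /= /weight; congr (_%:R).
  by lia.
- by [].
Qed.

(** In the plane [x_i = 0], the factor [t_i ^ n] selects the parameter [n] on every
    line, so the count is no longer a sum over the line but detects [(n,n,n)]. *)
Lemma laurent_plane_square n X : uniq X -> order_ideal X ->
  all (fun x : npoint 4 => x i == 0) X ->
  laurent (fun t => dual (Pcompl i) t * t i ^+ n * genfun X t * dual (genfun X) t)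
    (\sum_(x <- X) [&& x j == n, x k == n & x l == n]%:R) 0.
Proof.
pose A t := dual (Pcompl i) t * t i ^+ n; rewrite -/(A _) => uX iX QX.
have L := @laurent_selfproduct F (fun x : npoint 4 => x i == 0) A (fun=> 0)
  (fun x => [&& x j == n, x k == n & x l == n]%:R).
apply: laurent_ext (L _ X uX iX QX) _ _ _ => //; last first.
  by apply: eq_bigr => x _; rewrite add0r.
move=> {uX iX QX L}mu {}X nmu uX iX imuX /= /andP[/eqP mui /allP QX]; split.
  have := @laurent_corners F [:: j; k; l] X [::]
    (fun a => weight mu a - (a == i)%:Z * n.+1%:Z) isT uX isT ujkl _.
  move=> H; apply: laurent_ext (laurentN (H _)) _ _ _ => {H}.
  - move=> e eS c x xE; rewrite in_nil; apply/negbTE/negP => xX.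
    have xi : x i = 0 by apply/eqP/QX.
    have ei : e i = 0 by have := eS i; rewrite !inE !(four_neq u) /=; lia.
    (* the i-th coordinate forces c = - (n + 1), and then x dominates mu *)
    have cE : c = - n.+1%:Z by have := xE i; rewrite /weight eqxx xi mui ei; lia.
    case/negP: nmu; apply: iX xX _ => b.
    have := xE b; have := eS b; rewrite cE /weight.
    by case: (four_cases b) => ->; rewrite !inE !(four_neq u) ?eqxx /= ?mui; lia.
  - move=> t tt; rewrite -char_delta_exp // /A dual_PcomplE // PcomplE !big_cons big_nil.
    by rewrite -exprnP exprS; ring.
  - by rewrite big_nil oppr0.
  - by rewrite oppr0.
have := @laurent_corners F [:: j; k; l] (mu :: X) [:: n]
  (fun a => weight mu a - (a == i)%:Z * - n%:Z) isT _ isT ujkl _.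
move=> H; apply: laurent_ext (H _ _) _ _ _ => {H}.
- by rewrite /= nmu.
- move=> e eS c x xE; rewrite [c \in _]inE /=.
  have ei : e i = 0 by have := eS i; rewrite !inE !(four_neq u) /=; lia.
  apply/idP/eqP => [xX|cE].
    have xi : x i = 0.
      by move: xX; rewrite in_cons => /predU1P[->//|/QX/eqP].
    by have := xE i; rewrite /weight eqxx xi mui ei; lia.
  apply: (imuX _ _ (mem_head mu X)) => b.
  have := xE b; have := eS b; rewrite cE /weight.
  by case: (four_cases b) => ->; rewrite !inE !(four_neq u) ?eqxx /= ?mui; lia.
- move=> t tt; rewrite -char_delta_exp // /A /dual /=.
  have -> : (fun a => ((t a)^-1)^-1) = t by apply/funext => a; rewrite invrK.
  by rewrite PcomplE !big_cons big_nil -invr_expz -exprnP exprVn; ring.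
- rewrite big_seq1 corner4 !inE !(four_neq u) ?eqxx /= /weight; congr (_%:R).
  by lia.
- by [].
Qed.

End Products.

(** * The Laurent polynomials in the vertex *)

Section Terms.
Variable pi : set (npoint 4).
Hypotheses (sp : solid_partition pi) (fin : finite_asymptotics pi).
Variables (K N : nat).
Hypotheses (bK : shape_bound pi K) (KN : (K <= N)%N).
Variable F : fieldType.
Implicit Types (t : 'I_4 -> F) (i a b : 'I_4).

Definition dominant i (x : npoint 4) : int := (`[< dominant_diagonal i x >])%:R.
Definition central (x : npoint 4) : int := (trivial_weight (weight x))%:R.

Lemma dominant4 i j k l x : uniq [:: i; j; k; l] ->
  dominant i x = [&& x j == x k, x j == x l & (x j < x i)%N]%:R.
Proof.
move=> u; rewrite /dominant; congr (nat_of_bool _)%:R.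
apply/asboolP/and3P => [D|[/eqP jk /eqP jl ji] b c bi ci].
  have [jk jx] := D j k (negbT (four_neq u).1.1.2.1.1) (negbT (four_neq u).1.2.1.1).
  have [jl _] := D j l (negbT (four_neq u).1.1.2.1.1) (negbT (four_neq u).2.1.1).
  by rewrite -jk -jl eqxx.
have E e : e != i -> x e = x j.
  by case: (four_cases u e) => -> //; rewrite ?eqxx.
by rewrite (E b bi) (E c ci).
Qed.

Lemma boxed_ideal : order_ideal (boxed pi N).
Proof.
move=> x y /mem_boxed[piy yN] xy; apply/mem_boxed; split; first exact: sp piy xy.
by move=> a; apply: leq_trans (xy a) (yN a).
Qed.

Lemma boxed_le (x : npoint 4) a : x \in boxed pi N -> (x a <= N)%N.
Proof. by case/mem_boxed=> _; apply. Qed.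

Lemma profile_lt a b n y : y \in profile pi a -> b != a -> (insert_coord a n y b < K)%N.
Proof.
case: bK => ltK _ /(mem_profile fin) ya; case: (unliftP a b) => [j|] ->; last by rewrite eqxx.
by rewrite insert_coord_lift => _; apply: ltK ya j.
Qed.

Lemma insert_boxed a y : y \in profile pi a -> insert_coord a N y \in boxed pi N.
Proof.
move=> ya; apply/mem_boxed; split; first by move/(mem_profile fin): ya.
move=> b; have [->|ba] := eqVneq b a; first by rewrite insert_coord_at.
by apply: leq_trans KN; apply/ltnW/profile_lt.
Qed.

Lemma insert_coord_off a b m n y : b != a -> insert_coord a m y b = insert_coord a n y b.
Proof.
case: (unliftP a b) => [j|] ->; last by rewrite eqxx.
by rewrite !insert_coord_lift.
Qed.

(** The part of the geometric series of the a-th leg outside the box. *)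
Definition leg_end a t : F := Zasym pi a t / (1 - t a) * t a ^+ N.+1.

Lemma leg_endE a t : torus_point t ->
  (1 - t a) * leg_end a t = genfun [seq insert_coord a N.+1 y | y <- profile pi a] t.
Proof.
case=> _ t1 _; rewrite (genfun_insert fin) /leg_end.
have : 1 - t a != 0 by rewrite subr_eq0 eq_sym.
by move=> ta; field.
Qed.

(** The factor [1 - t a] is - t_a (1 - 1 / t_a), which moves the end of the leg down to
    the height [N], the last layer inside the box. *)
Lemma dual_leg_endE a t : torus_point t ->
  (1 - t a) * dual (leg_end a) t =
  - \sum_(y <- profile pi a) char t (fun b => - weight (insert_coord a N y) b).
Proof.
move=> tt; have -> : \sum_(y <- profile pi a) char t (fun b => - weight (insert_coord a N y) b)
   = (t a)^-1 ^+ N * dual (Zasym pi a) t.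
  rewrite /dual -(genfun_insert fin) /genfun big_map; apply: eq_bigr => y _.
  by rewrite -char_inv.
case: tt => t0 t1 _; have ta : t a - 1 != 0 by rewrite subr_eq0.
by rewrite /leg_end /dual exprS; field; rewrite ta t0.
Qed.

Definition Pall t : F := \prod_a (1 - t a).

Lemma sum_iota (R : nmodType) (f : nat -> R) n : \sum_(c <- iota 0 n) f c = \sum_(c < n) f c.
Proof. by rewrite -(big_mkord xpredT) /index_iota subn0. Qed.

(** The three remaining factors of the product select, for each [y] in [lambda_a], the
    corner where all coordinates of [y] are equal. *)
Lemma laurent_leg_end a :
  laurent (fun t => Pall t * Znor pi N t * dual (leg_end a) t)
    (- \sum_(y <- profile pi a) \sum_(n < N.+1) central (insert_coord a n y)) 0.
Proof.
have [b ab] : exists b, a != b by exists (lift a 0); rewrite neq_lift.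
have [k [l u]] := complete_four ab.
have H := laurent_big (profile pi a) (P := mem (profile pi a)) (fun y ya =>
  @laurent_end F [:: b; k; l] (boxed pi N) _ a N isT (ujkl u) _ (boxed_uniq pi N)
    boxed_ideal (insert_boxed ya) (insert_coord_at a N y) (fun x => @boxed_le x a)).
apply: laurent_ext (laurentN (H _)) _ _ _ => [|t tt||].
- by rewrite !inE !(four_neq u).
- rewrite ZnorE -big_seq !big_cons big_nil.
  rewrite /Pall (big_four _ _ u) /=.
  transitivity ((1 - t b) * ((1 - t k) * (1 - t l)) * genfun (boxed pi N) t *
     ((1 - t a) * dual (leg_end a) t)); first by ring.
  rewrite dual_leg_endE // mulrN; congr (- _); rewrite mulr_sumr.
  by apply: eq_bigr => y _; ring.
- rewrite -big_seq; congr (- _); apply: eq_bigr => y ya; rewrite sum_iota.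
  apply: eq_bigr => n _; rewrite /central (corner4 u) (trivial_weight4 u) !inE !(four_neq u) ?eqxx /weight.
  rewrite !insert_coord_at !(@insert_coord_off a _ n N) ?(four_neq u) //.
  by rewrite /=; congr (nat_of_bool _)%:R; have := ltn_ord n; lia.
- by rewrite big1 ?oppr0.
Qed.


(** Two of the three factors of [P_jkl] survive; the coordinates [c] and [d] of [y]
    must coincide and be at most the i-th one. *)
Lemma laurent_leg_end_dual i a : i != a ->
  laurent (fun t => dual (Pcompl i) t * dual (Znor pi N) t * leg_end a t)
    (- \sum_(y <- profile pi a) \sum_(n < N.+1)
         (dominant i (insert_coord a n y) + central (insert_coord a n y))) 0.
Proof.
move=> ia; have [c [d u]] := complete_four ia.
have ucd : uniq [:: c; d] by rewrite /= inE (four_neq u).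
have H := laurent_big (profile pi a) (P := mem (profile pi a)) (fun y ya =>
  @laurent_end F [:: c; d] (boxed pi N) _ a N isT ucd _ (boxed_uniq pi N)
    boxed_ideal (insert_boxed ya) (insert_coord_at a N y) (fun x => @boxed_le x a)).
suff G : laurent (fun t => Pcompl i t * Znor pi N t * dual (leg_end a) t)
    (- \sum_(y <- profile pi a) \sum_(n < N.+1)
         (dominant i (insert_coord a n y) + central (insert_coord a n y))) 0.
  apply: laurent_ext (laurent_dual G) _ _ _ => // t _; rewrite /dual /=.
  by congr (_ * leg_end a _); apply/funext => b; rewrite invrK.
apply: laurent_ext (laurentN (H _)) _ _ _ => [|t tt||].
- by rewrite !inE !(four_neq u).
- rewrite ZnorE -big_seq (PcomplE u).
  transitivity (((1 - t c) * (1 - t d)) * genfun (boxed pi N) t *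
     ((1 - t a) * dual (leg_end a) t)); first by ring.
  rewrite dual_leg_endE // mulrN; congr (- _); rewrite mulr_sumr.
  by apply: eq_bigr => y _; rewrite !big_cons big_nil; ring.
- rewrite -big_seq; congr (- _); apply: eq_bigr => y ya; rewrite sum_iota.
  apply: eq_bigr => n _.
  rewrite /central (dominant4 _ u) (corner4 u) (trivial_weight4 u) !inE !(four_neq u) ?eqxx /weight.
  rewrite !insert_coord_at !(@insert_coord_off a _ n N) ?(four_neq u) //.
  by rewrite /=; have := ltn_ord n; lia.
- by rewrite big1 ?oppr0.
Qed.

Lemma laurent_cross_compl i a b c : uniq [:: i; a; b; c] ->
  laurent (fun t => dual (Pcompl i) t * leg_end a t * dual (leg_end b) t) 0 0.
Proof.
move=> u; have uX : uniq [seq insert_coord a N.+1 y | y <- profile pi a].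
  by rewrite map_inj_uniq ?profile_uniq //; apply: can_inj (insert_coordK _ _).
have H := laurent_big (profile pi b) (P := mem (profile pi b)) (fun z zb =>
  @laurent_cross F [:: c] [seq insert_coord a N.+1 y | y <- profile pi a]
    (fun e => weight (insert_coord b N z) e - (e == i)%:Z) a b isT isT _ _ uX _ (_ zb)).
apply: laurent_ext (H _ _ _ _) _ _ _ => [|||z zb|t tt||].
- by rewrite !inE !(four_neq u).
- by rewrite !inE !(four_neq u).
- move=> x /mapP[y ya ->]; rewrite insert_coord_at.
  by apply: leq_trans (leqW KN); apply: profile_lt ya _; rewrite (four_neq u).
- rewrite !(four_neq u) !subr0 /weight insert_coord_at lez_nat.
  by apply: leq_trans KN; apply/ltnW/profile_lt; rewrite // (four_neq u).
- rewrite -big_seq (dual_PcomplE u) // (PcomplE u).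
  transitivity (- (t i * (1 - t c) * ((1 - t a) * leg_end a t) *
     ((1 - t b) * dual (leg_end b) t))); first by ring.
  rewrite dual_leg_endE // leg_endE // mulrN opprK mulr_sumr.
  by apply: eq_bigr => z _; rewrite -char_delta // big_seq1; ring.
- by rewrite big1.
- by rewrite big1.
Qed.

Lemma laurent_cross_all a b : a != b ->
  laurent (fun t => Pall t * leg_end a t * dual (leg_end b) t) 0 0.
Proof.
move=> ab; have [c [d u]] := complete_four ab.
have ucd : uniq [:: c; d] by rewrite /= inE (four_neq u).
have uX : uniq [seq insert_coord a N.+1 y | y <- profile pi a].
  by rewrite map_inj_uniq ?profile_uniq //; apply: can_inj (insert_coordK _ _).
have H := laurent_big (profile pi b) (P := mem (profile pi b)) (fun z zb =>
  @laurent_cross F [:: c; d] [seq insert_coord a N.+1 y | y <- profile pi a]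
    (weight (insert_coord b N z)) a b isT ucd _ _ uX _ (_ zb)).
apply: laurent_ext (laurentN (H _ _ _ _)) _ _ _ => [|||z zb|t tt||].
- by rewrite !inE !(four_neq u).
- by rewrite !inE !(four_neq u).
- move=> x /mapP[y ya ->]; rewrite insert_coord_at.
  by apply: leq_trans (leqW KN); apply: profile_lt ya _; rewrite (four_neq u).
- rewrite /weight insert_coord_at lez_nat.
  by apply: leq_trans KN; apply/ltnW/profile_lt; rewrite // (four_neq u).
- rewrite -big_seq /Pall (big_four _ _ u) /=.
  transitivity ((1 - t c) * (1 - t d) * ((1 - t a) * leg_end a t) *
     ((1 - t b) * dual (leg_end b) t)); first by ring.
  rewrite dual_leg_endE // leg_endE // mulrN mulr_sumr; congr (- _).
  by apply: eq_bigr => z _; rewrite !big_cons big_nil; ring.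
- by rewrite big1 // oppr0.
- by rewrite big1 // oppr0.
Qed.

(** The Laurent polynomial [Q_i Y_i Y_i~ + P E_i~ Y_i], in which only the i-th leg
    enters, is anti-self-dual; this is one half of it. *)
Definition half_leg i t : F :=
  dual (Pcompl i) t * Zasym pi i t * dual (Zasym pi i) t *
  \sum_(m < N.+1) \sum_(n < m.+1) t i ^+ n.

(** For fixed [m], the sum over [n <= m] of [laurent_plane_square] detects whether the
    box at height [m] over [y] satisfies [y_j = y_k = y_l <= m]. *)
Lemma laurent_half_leg i :
  laurent (half_leg i)
    (\sum_(y <- profile pi i) \sum_(n < N.+1)
       (dominant i (insert_coord i n y) + central (insert_coord i n y))) 0.
Proof.
clear bK KN.
have [j ij] : exists j, i != j by exists (lift i 0); rewrite neq_lift.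
have [k [l u]] := complete_four ij.
pose X := [seq insert_coord i 0 y | y <- profile pi i].
have uX : uniq X.
  by rewrite map_inj_uniq ?profile_uniq //; apply: can_inj (insert_coordK _ _).
have iX : order_ideal X.
  move=> x z /mapP[y /(mem_profile fin) yi ->] xy.
  have xi : x i = 0%N by apply/eqP; rewrite -leqn0; have := xy i; rewrite insert_coord_at.
  apply/mapP; exists (delete_coord i x); last by rewrite -{1}(delete_coordK i x) xi.
  apply/(mem_profile fin); apply: (asymptotic_le sp yi) => e.
  by have := xy (lift i e); rewrite insert_coord_lift ffunE.
have QX : all (fun x : npoint 4 => x i == 0) X.
  by apply/allP => x /mapP[y _ ->]; rewrite insert_coord_at.
have H := laurent_big (index_enum 'I_N.+1) (P := xpredT) (fun m _ =>
  laurent_big (index_enum 'I_m.+1) (P := xpredT) (fun n _ =>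
    @laurent_plane_square F i j k l u n X uX iX QX)).
apply: laurent_ext H _ _ _ => [t tt||].
- have XE s : genfun X s = Zasym pi i s by rewrite (genfun_insert fin) mul1r.
  rewrite /half_leg /dual mulr_sumr; apply: eq_bigr => m _; rewrite mulr_sumr.
  by apply: eq_bigr => n _; rewrite !XE; ring.
- rewrite exchange_big /=; apply: eq_bigr => m _.
  rewrite exchange_big /= big_map; apply: eq_bigr => y _.
  rewrite /central (dominant4 _ u) (trivial_weight4 u) /weight insert_coord_at.
  rewrite !(@insert_coord_off i _ m 0) ?(four_neq u) //.
  set p := insert_coord i 0 y.
  (* if all coordinates of y agree, only n = p j contributes, provided p j <= m *)
  have [le|lt] := leqP (p j) m.
    rewrite (bigD1 (Ordinal (le : (p j < m.+1)%N))) //= eqxx big1 ?addr0.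
      by lia.
    move=> n /eqP nj; have -> // : (p j == n) = false.
    by apply/negbTE/eqP => pj; apply: nj; apply/val_inj.
  rewrite big1; first by lia.
  by move=> n _; have := ltn_ord n; lia.
- by rewrite big1 // => m _; rewrite big1.
Qed.

Lemma laurent_Znor_legs : exists r,
  laurent (fun t => Znor pi N t - \sum_a Zleg pi N a t)
    (\sum_(x <- boxed pi N) central x -
     \sum_a \sum_(y <- profile pi a) \sum_(n < N.+1) central (insert_coord a n y)) r.
Proof.
have L x : laurent (fun t => \prod_a t a ^+ (x : npoint 4) a) (central x) 1.
  by have := laurent_char F (weight x).
have H := laurentB (laurent_big (boxed pi N) (P := xpredT) (fun x _ => L x))
  (laurent_big (index_enum 'I_4) (P := xpredT) (fun a _ =>
    laurent_big (profile pi a) (P := xpredT) (fun y _ =>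
    laurent_big (index_enum 'I_N.+1) (P := xpredT) (fun n _ => L (insert_coord a n y))))).
eexists; apply: laurent_ext H _ _ _ => // t tt; rewrite ZnorE; congr (_ - _).
apply: eq_bigr => a _; rewrite /Zleg mulr_sumr exchange_big; apply: eq_bigr => n _ /=.
by rewrite mulrC -(genfun_insert fin) /genfun big_map.
Qed.

End Terms.

(** * Closed form of the vertex *)

Section ClosedForm.
Variable pi : set (npoint 4).
Hypotheses (sp : solid_partition pi) (fin : finite_asymptotics pi).
Variables (K N : nat).
Hypotheses (bK : shape_bound pi K) (KN : (K <= N)%N).
Variable F : fieldType.
Implicit Types (t : 'I_4 -> F) (i a b : 'I_4).

Local Notation X := (Znor pi N).
Local Notation Y := (Zleg pi N).
Local Notation E := (leg_end pi N).
Local Notation Q i := (dual (Pcompl i)).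

Lemma dual_inv (f : ('I_4 -> F) -> F) t : dual f (fun a => (t a)^-1) = f t.
Proof. by rewrite -[RHS](congr1 (fun g => g t) (dualK f)). Qed.

Lemma Zasym_split a t : torus_point t -> Zasym pi a t = (1 - t a) * (Y a t + E a t).
Proof.
case=> _ t1 _; have ta : 1 - t a != 0 by rewrite subr_eq0 eq_sym.
have geo : (1 - t a) * \sum_(n < N.+1) t a ^+ n = 1 - t a ^+ N.+1.
  by rewrite -opprB mulNr -subrX1 opprB.
rewrite /Zleg /leg_end mulrDr [X in X + _]mulrCA geo.
by field.
Qed.

Lemma Pall_split i t : torus_point t -> Pall t = Q i t + Pcompl i t.
Proof.
move=> tt; have [j ij] : exists j, i != j by exists (lift i 0); rewrite neq_lift.
have [k [l u]] := complete_four ij.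
rewrite (dual_PcomplE u) // /Pall (bigD1 i) //= /Pcompl /Pfun.
under [X in _ = - (_ * X) + _]eq_bigl do rewrite !inE.
by under [X in _ = _ + X]eq_bigl do rewrite !inE; ring.
Qed.

Lemma correctionE i t : correction pi N i t =
  Q i t * Y i t * (dual X t - dual (Y i) t + \sum_(a | a != i) dual (E a) t).
Proof.
rewrite /correction -[RHS]mulrA; congr (_ * _); rewrite [RHS]mulrDr; congr (_ + _).
rewrite mulr_sumr; apply: eq_bigr => a _.
by rewrite /leg_end /dual exprVn; ring.
Qed.

(** The correction [f^i_{lambda_a}] compensates the product [E_a E_a~], which has two
    denominators for the single factor [1 - 1 / t_a] of [Q_i]. *)
Lemma fleg_split i a t : torus_point t -> a != i ->
  fleg pi i a t / (1 - t a) = Q i t * E a t * dual (E a) t - (Y a t + E a t).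
Proof.
move=> tt; rewrite eq_sym => ia; have [c [d u]] := complete_four ia.
rewrite /fleg {1 2}(Zasym_split _ tt).
case: (tt) => t0 t1 _; have ta : 1 - t a != 0 by rewrite subr_eq0 eq_sym.
have ta' : t a - 1 != 0 by rewrite subr_eq0.
have -> : dual (Pfun (~: [set i; a])) t = (1 - (t c)^-1) * (1 - (t d)^-1).
  exact: (Pfun2E u).
have -> : Q i t = (1 - (t a)^-1) * ((1 - (t c)^-1) * (1 - (t d)^-1)).
  exact: (PcomplE u).
have GE : (1 - t a) * (Y a t + E a t) * t a ^+ N.+1 = (1 - t a) * E a t.
  by rewrite -Zasym_split // /leg_end; field.
have EG : (1 - t a) * E a t * (t a ^+ N.+1)^-1 = (1 - t a) * (Y a t + E a t).
  by rewrite -GE mulfK // expf_neq0.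
have -> : dual (E a) t = dual (Zasym pi a) t / (1 - (t a)^-1) * (t a ^+ N.+1)^-1.
  by rewrite -exprVn.
rewrite -[X in _ = _ * X * _ - _](mulKf ta) -GE.
have tN : t a ^+ N.+1 != 0 by rewrite expf_neq0.
move: (t a ^+ N.+1) tN (dual _ _) (Y a t + E a t) (1 - (t c)^-1) (1 - (t d)^-1).
by move=> z z0 l g p q; field; rewrite ta' ta z0 t0.
Qed.

Lemma geometric (x : F) n : x != 1 -> \sum_(k < n) x ^+ k = (1 - x ^+ n) / (1 - x).
Proof.
move=> x1; have x1' : 1 - x != 0 by rewrite subr_eq0 eq_sym.
by apply: (mulIf x1'); rewrite divfK // mulrC -opprB mulNr -subrX1 opprB.
Qed.

Lemma geometric2 (x : F) n : x != 1 ->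
  \sum_(m < n) \sum_(k < m.+1) x ^+ k = (n%:R - x * ((1 - x ^+ n) / (1 - x))) / (1 - x).
Proof.
move=> x1; rewrite -geometric //.
under eq_bigr do rewrite geometric //.
rewrite -mulr_suml sumrB sumr_const card_ord mulr_sumr.
by under [in RHS]eq_bigr do rewrite -exprS.
Qed.

Lemma Pcompl_dual i t : torus_point t -> Pcompl i t = - ((t i)^-1 * Q i t).
Proof.
move=> tt; have [j ij] : exists j, i != j by exists (lift i 0); rewrite neq_lift.
have [k [l u]] := complete_four ij.
by rewrite (dual_PcomplE u) // mulrN opprK mulrA mulVf ?mul1r //; case: tt.
Qed.

Lemma half_leg_split i t : torus_point t ->
  half_leg pi N i t - dual (half_leg pi N i) t =
  Q i t * Y i t * dual (Y i) t + Pall t * dual (E i) t * Y i t.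
Proof.
move=> tt.
have -> : dual (half_leg pi N i) t = Pcompl i t * dual (Zasym pi i) t * Zasym pi i t *
    \sum_(m < N.+1) \sum_(n < m.+1) (t i)^-1 ^+ n.
  by rewrite /half_leg {1}/dual !dual_inv.
rewrite /half_leg.
rewrite (Pall_split i tt) (Pcompl_dual i tt).
have -> : dual (Y i) t = dual (Zasym pi i) t * \sum_(n < N.+1) (t i)^-1 ^+ n by [].
have -> : dual (E i) t = dual (Zasym pi i) t / (1 - (t i)^-1) * (t i)^-1 ^+ N.+1 by [].
rewrite /Zleg.
case: tt => t0 t1 _.
have x1' : 1 - t i != 0 by rewrite subr_eq0 eq_sym.
have x1 : t i - 1 != 0 by rewrite subr_eq0.
have s1 : (t i)^-1 != 1 by rewrite -[1]invr1 (inj_eq invr_inj).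
rewrite !geometric2 // !geometric // exprVn.
have z0 : t i ^+ N.+1 != 0 by rewrite expf_neq0.
move: (t i) (t0 i) x1 x1' s1 (t i ^+ N.+1) z0 (dual (Zasym pi i) t) (Zasym pi i t) (Q i t).
move=> x x0 x1 x1' s1 z z0 la' la q.
by field; rewrite x0 x1 x1' z0.
Qed.

(** [Q_i / (1 - t_i)] equals the dual expression [P_jkl / (1 - 1 / t_i)]. *)
Lemma leg_term_split i t : torus_point t ->
  (1 - t i)^-1 *
      (- Zasym pi i t
       + Q i t * (dual (Zpi pi) t * Zasym pi i t - Zpi pi t * dual (Zasym pi i) t)
       + Q i t / (1 - t i) * Zasym pi i t * dual (Zasym pi i) t) =
  - (Y i t + E i t) + Q i t * dual (Zpi pi) t * (Y i t + E i t)
  - Pcompl i t * Zpi pi t * (dual (Y i) t + dual (E i) t)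
  + Pcompl i t * (Y i t + E i t) * (dual (Y i) t + dual (E i) t).
Proof.
move=> tt; have tt' := torus_point_inv tt.
have -> : dual (Zasym pi i) t = (1 - (t i)^-1) * (dual (Y i) t + dual (E i) t).
  exact: (Zasym_split i tt').
rewrite (Zasym_split i tt) (Pcompl_dual i tt).
case: tt => t0 t1 _.
have x1' : 1 - t i != 0 by rewrite subr_eq0 eq_sym.
by field; rewrite t0 x1'.
Qed.

Definition cross_end i a t : F := Q i t * dual X t * E a t.

Definition cross_ends i t : F :=
  \sum_(a | a != i) \sum_(b | b != i) (if b == a then 0 else Q i t * E a t * dual (E b) t)
  + \sum_(b | b != i) Pall t * E b t * dual (E i) t.

(** Once the denominators are hidden in the [E_a], the identity holds with [X], the
    [Y_a], the [E_a] and their duals treated as indeterminates. *)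
Lemma vertex'E i t : torus_point t ->
  vertex' pi N i t =
    (X t - \sum_a Y a t) - Q i t * X t * dual X t
    + (half_leg pi N i t - dual (half_leg pi N i) t)
    - \sum_a Pall t * X t * dual (E a) t
    - \sum_(a | a != i) (cross_end i a t - dual (cross_end i a) t)
    - cross_ends i t.
Proof.
move=> tt; have tt' := torus_point_inv tt.
have [j ij] : exists j, i != j by exists (lift i 0); rewrite neq_lift.
have [k [l u]] := complete_four ij.
have ZE : Zpi pi t = X t + \sum_a E a t.
  by apply: (ZpiE fin bK) => //; case: tt.
have ZE' : dual (Zpi pi) t = dual X t + \sum_a dual (E a) t.
  by apply: (ZpiE fin bK) => //; case: tt'.
have -> : vertex' pi N i t = vertex pi i t - correction pi N i t +
    correction pi N i (fun a => (t a)^-1) by [].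
have -> : correction pi N i (fun a => (t a)^-1) =
    Pcompl i t * dual (Y i) t * (X t - Y i t + \sum_(a | a != i) E a t).
  rewrite correctionE !dual_inv; congr (_ * (_ + _)).
  by apply: eq_bigr => a _; rewrite dual_inv.
rewrite correctionE half_leg_split //.
rewrite /vertex /= -!/(Pcompl i) leg_term_split // ZE ZE'.
rewrite (eq_bigr _ (fun a ai => fleg_split tt ai)).
rewrite /cross_ends !(big_compl _ _ u) !(big_four _ _ u) /= !eqxx !(four_neq u).
have CE a : dual (cross_end i a) t = Pcompl i t * X t * dual (E a) t.
  by rewrite /cross_end {1}/dual !dual_inv.
rewrite !(Pall_split i tt) !CE /cross_end.
rewrite -[dual (Pfun (~: [set i]%SET)) t]/(Q i t).
by ring.
Qed.

End ClosedForm.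

(** * Virtual representations and Euler classes *)

(** Sums and products over the support of a class are compared for different classes
    by widening them to a common index set. *)
Section DomainSums.
Variables (R : Type) (idx : R) (op : Monoid.com_law idx).

Lemma big_dom_widen (V : K0) (s : seq 'rV[int]_3) (f : 'rV[int]_3 -> R) :
  uniq s -> {subset dom V <= s} -> (forall mu, coeff mu V = 0 -> f mu = idx) ->
  \big[op/idx]_(mu <- dom V) f mu = \big[op/idx]_(mu <- s) f mu.
Proof.
move=> us sub f0; rewrite [RHS](bigID (fun mu => mu \in dom V)) /= [X in _ = op _ X]big1 ?Monoid.mulm1.
  rewrite -[RHS]big_filter; apply: perm_big; apply: uniq_perm; rewrite ?uniq_dom ?filter_uniq //.
  by move=> mu; rewrite mem_filter; case: (boolP (mu \in dom V)) => // /sub.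
by move=> mu; rewrite mem_dom negbK => /eqP/f0.
Qed.

End DomainSums.

Lemma Freeg_cons (x : int * 'rV[int]_3) s : Freeg (x :: s) = Freeg [:: x] + Freeg s :> K0.
Proof. by rewrite -freeg_cat. Qed.

Lemma uniq_dom2 (A B : K0) (s := undup (dom A ++ dom B)) :
  [/\ uniq s, {subset dom A <= s}, {subset dom B <= s} & {subset dom (A + B) <= s}].
Proof.
split; rewrite ?undup_uniq //.
- by move=> x xA; rewrite mem_undup mem_cat xA.
- by move=> x xA; rewrite mem_undup mem_cat xA orbT.
- by move=> x /domD_subset xA; rewrite mem_undup.
Qed.

Lemma K0_ratfunD A B : K0_ratfun (A + B) = K0_ratfun A + K0_ratfun B.
Proof.
have [us sA sB sAB] := uniq_dom2 A B; rewrite /K0_ratfun.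
rewrite (big_dom_widen _ us sA) ?(big_dom_widen _ us sB) ?(big_dom_widen _ us sAB);
  try by move=> mu ->; rewrite mulr0z.
by rewrite -big_split; apply: eq_bigr => mu _; rewrite coeffD mulrzDr.
Qed.

Lemma K0_ratfun0 : K0_ratfun 0 = 0.
Proof. by rewrite /K0_ratfun dom0 big_nil. Qed.

Lemma K0_ratfunN A : K0_ratfun (- A) = - K0_ratfun A.
Proof. by apply/eqP; rewrite -addr_eq0 -K0_ratfunD addNr K0_ratfun0. Qed.

Lemma K0_ratfun_Freeg s : K0_ratfun (Freeg s) = laurent_sum s tgen.
Proof.
elim: s => [|[c mu] s IHs]; first by rewrite freeg_nil K0_ratfun0 /laurent_sum big_nil.
rewrite Freeg_cons K0_ratfunD IHs /laurent_sum big_cons /=; congr (_ + _).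
have [->|c0] := eqVneq c 0; first by rewrite freegU0 K0_ratfun0 mulr0z.
by rewrite /K0_ratfun domU // big_seq1 coeffU eqxx mulr1.
Qed.

Lemma var3E j : tgen (lift ord_max j) = var3 j.
Proof. by rewrite /tgen liftK. Qed.

Local Notation tofrac := (@FracField.tofrac {mpoly rat[3]}).

Lemma tofrac_inj : injective tofrac.
Proof. by move=> p q /eqP; rewrite tofrac_eq => /eqP. Qed.

Lemma mpolyX_neq0 (m : 'X_{1..3}) : 'X_[m] != 0 :> {mpoly rat[3]}.
Proof.
apply/eqP => /(congr1 (mcoeff m)); rewrite mcoeffX eqxx mcoeff0.
by move/eqP; rewrite oner_eq0.
Qed.

Lemma var3_neq0 j : var3 j != 0.
Proof. by rewrite tofrac_eq0 mpolyX_neq0. Qed.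

Lemma prod_var3 (m : 'X_{1..3}) : \prod_(j < 3) var3 j ^+ m j = tofrac 'X_[m].
Proof.
rewrite mpolyXE_id rmorph_prod; apply: eq_bigr => j _.
by rewrite rmorphXn.
Qed.

Lemma tofracX_neq1 (m : 'X_{1..3}) : m != 0%MM -> tofrac 'X_[m] != 1.
Proof.
move=> m0; rewrite -[1](rmorph1 tofrac) (inj_eq tofrac_inj).
apply/eqP => /(congr1 (mcoeff 0%MM)); rewrite mcoeffX mcoeff1 eqxx (negPf m0).
by move/eqP; rewrite eq_sym oner_eq0.
Qed.

Lemma torus_tgen : torus_point tgen.
Proof.
have tmax : tgen ord_max = (tofrac 'X_[[multinom 1 | j < 3]])^-1.
  rewrite /tgen unlift_none -prod_var3; congr _^-1.
  by apply: eq_bigr => j _; rewrite mnmE.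
split=> [a|a|].
- case: (unliftP ord_max a) => [j|] ->; first by rewrite var3E var3_neq0.
  by rewrite tmax invr_eq0 tofrac_eq0 mpolyX_neq0.
- case: (unliftP ord_max a) => [j|] ->.
    rewrite var3E; apply: tofracX_neq1; apply/eqP => /mnmP/(_ j).
    by rewrite mnm1E eqxx mnm0E.
  rewrite tmax -[1]invr1 (inj_eq invr_inj); apply: tofracX_neq1.
  by apply/eqP => /mnmP/(_ ord0); rewrite mnmE mnm0E.
rewrite (bigD1_ord ord_max) //=.
under eq_bigr do rewrite var3E.
rewrite /tgen unlift_none mulVf //; apply/prodf_neq0 => j _; exact: var3_neq0.
Qed.

(** The characters are linearly independent: a large power of [t_1 t_2 t_3] turns the
    ones in the support into distinct monomials of the polynomial ring. *)
Lemma K0_ratfun_eq0 V : K0_ratfun V = 0 -> V = 0.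
Proof.
move=> V0; apply/eqP/freeg_eqP => mu0; rewrite coeff0.
have [mu0V|] := boolP (mu0 \in dom V); last by apply: coeff_outdom.
(* B makes all exponents mu_j + B nonnegative *)
pose B : nat := (\sum_(mu <- dom V) \sum_j `|(mu 0%R j)|)%N.
have posB (mu : 'rV[int]_3) j : mu \in dom V -> 0 <= mu 0 j + B%:Z.
  move=> muV; suff : (`|(mu 0%R j)| <= B)%N by lia.
  rewrite /B (big_rem mu) //= (bigD1 j) //= -addnA; exact: leq_addr.
pose e (mu : 'rV[int]_3) := [multinom absz (mu 0%R j + B%:Z)%R | j < 3].
have eE mu : mu \in dom V ->
    (\prod_j var3 j) ^+ B * \prod_(j < 3) tgen (lift ord_max j) ^ mu 0 j = tofrac 'X_[e mu].
  move=> muV; rewrite -prod_var3 -prodrXl -big_split; apply: eq_bigr => j _ /=.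
  rewrite var3E mnmE exprnP -expfzDr ?var3_neq0 // exprnP; congr (_ ^ _).
  by have := posB mu j muV; lia.
have /tofrac_inj sum0 :
    tofrac (\sum_(mu <- dom V) 'X_[e mu] *~ coeff mu V) = tofrac 0.
  rewrite rmorph0 rmorph_sum -[RHS](mulr0 ((\prod_j var3 j) ^+ B)).
  rewrite -[X in _ = _ * X]V0 /K0_ratfun mulr_sumr.
  by apply: eq_big_seq => mu muV; rewrite rmorphMz /= -eE // mulrzAr.
have := congr1 (mcoeff (e mu0)) sum0; rewrite mcoeff0 raddf_sum.
rewrite (bigD1_seq mu0) ?uniq_dom //= big1_seq ?addr0.
  rewrite raddfMz /= mcoeffX eqxx; move/eqP; by rewrite intr_eq0 => /eqP.
move=> mu /andP[mumu0 muV]; rewrite raddfMz /= mcoeffX.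
case: eqP => [ee|_]; last by rewrite mul0rz.
case/eqP: mumu0; apply/rowP => j; have /mnmP/(_ j) := ee; rewrite !mnmE.
have absD_inj (x y : int) : 0 <= x + B%:Z -> 0 <= y + B%:Z ->
  absz (x + B%:Z) = absz (y + B%:Z) -> x = y by lia.
by move=> /absD_inj; apply; apply: posB.
Qed.

(** * Signs of Euler classes *)

Definition weight_form (mu : 'rV[int]_3) : ratfun3 :=
  \sum_(j < 3) lambda_wt (lift ord_max j) *~ mu 0 j.

Lemma weight_formN mu : weight_form (- mu) = - weight_form mu.
Proof. by rewrite -sumrN; apply: eq_bigr => j _; rewrite mxE mulrNz. Qed.

Lemma weight_form_neq0 mu : mu != 0 -> weight_form mu != 0.
Proof.
apply: contra_neq => w0; apply/rowP => j; rewrite mxE.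
have /tofrac_inj p0 : FracField.tofrac (\sum_(k < 3) 'X_k *~ mu 0 k : {mpoly rat[3]}) = FracField.tofrac 0.
  rewrite rmorph0 -w0 rmorph_sum; apply: eq_bigr => k _.
  by rewrite rmorphMz /lambda_wt liftK.
have := congr1 (mcoeff U_(j)%MM) p0; rewrite mcoeff0 raddf_sum (bigD1 j) //= big1 ?addr0.
  by rewrite raddfMz /= mcoeffXU eqxx => /eqP; rewrite intr_eq0 => /eqP.
by move=> k kj; rewrite raddfMz /= mcoeffXU (negPf kj) mul0rz.
Qed.

(** Replacing the weight 0 of the trivial character by 1 makes the Euler class
    multiplicative on all classes and does not change it on movable ones. *)
Definition weight_form1 mu : ratfun3 := if mu == 0 then 1 else weight_form mu.

Lemma weight_form1_neq0 mu : weight_form1 mu != 0.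
Proof. by rewrite /weight_form1; case: (eqVneq mu 0) => [_|mu0]; [exact: oner_neq0 | exact: weight_form_neq0]. Qed.

Definition euler1 (V : K0) : ratfun3 := \prod_(mu <- dom V) weight_form1 mu ^ coeff mu V.

Lemma euler1D A B : euler1 (A + B) = euler1 A * euler1 B.
Proof.
have [us sA sB sAB] := uniq_dom2 A B; rewrite /euler1.
rewrite (big_dom_widen _ us sA) ?(big_dom_widen _ us sB) ?(big_dom_widen _ us sAB);
  try by move=> mu ->; rewrite expr0z.
by rewrite -big_split; apply: eq_bigr => mu _; rewrite coeffD expfzDr ?weight_form1_neq0.
Qed.

Lemma euler1_Freeg s : euler1 (Freeg s) = \prod_(x <- s) weight_form1 x.2 ^ x.1.
Proof.
elim: s => [|[c mu] s IHs]; first by rewrite freeg_nil /euler1 dom0 !big_nil.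
rewrite Freeg_cons euler1D IHs big_cons /=; congr (_ * _).
have [->|c0] := eqVneq c 0; first by rewrite freegU0 /euler1 dom0 big_nil expr0z.
by rewrite /euler1 domU // big_seq1 coeffU eqxx mulr1.
Qed.

Lemma euler1_movable V : movable V -> euler V = euler1 V.
Proof.
move=> V0; apply: eq_big_seq => mu; rewrite mem_dom /weight_form1.
by case: (eqVneq mu 0) => // ->; rewrite V0 eqxx.
Qed.

(** The classes [V] and [W] differ by [U - dual U], where [U] is the class of [s]; a
    nontrivial character of multiplicity [m] in [U] contributes [(-1)^m] to the
    quotient of the Euler classes, being replaced by its opposite. *)
Lemma euler_dual_shift (V W : K0) (s : seq (int * 'rV[int]_3)) :
  movable V -> movable W ->
  K0_ratfun V - K0_ratfun W = laurent_sum s tgen - dual (laurent_sum s) tgen ->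
  euler (- V) =
  (-1) ^ (\sum_(x <- s) x.1 - \sum_(x <- s | x.2 == 0) x.1) * euler (- W).
Proof.
move=> V0 W0 VW.
pose s' := [seq (x.1, - x.2) | x <- s].
have dualE : dual (laurent_sum s) tgen = K0_ratfun (Freeg s').
  rewrite K0_ratfun_Freeg /laurent_sum big_map /dual /laurent_sum.
  by apply: eq_bigr => x _; rewrite mono3_inv.
have {}VW : V + Freeg s' = W + Freeg s.
  apply/eqP; rewrite -subr_eq0; apply/eqP/K0_ratfun_eq0.
  rewrite K0_ratfunD K0_ratfunN !K0_ratfunD -dualE K0_ratfun_Freeg.
  by rewrite opprD addrACA VW; ring.
have {}VW : - V + Freeg s = - W + Freeg s'.
  by apply: (addrI V); rewrite addNKr [RHS]addrCA VW addKr.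
rewrite !euler1_movable; try by rewrite /movable coeffN ?V0 ?W0 oppr0.
have e0 : euler1 (Freeg s) != 0.
  by rewrite euler1_Freeg; rewrite prodf_seq_neq0; apply/allP => x _ /=; rewrite expfz_neq0 ?weight_form1_neq0.
apply: (mulIf e0); rewrite -euler1D VW euler1D mulrAC [RHS]mulrC; congr (_ * _).
rewrite !euler1_Freeg big_map /=.
have -> : \sum_(x <- s) x.1 - \sum_(x <- s | x.2 == 0) x.1 = \sum_(x <- s) (if x.2 == 0 then 0 else x.1).
  by rewrite [X in _ - X]big_mkcond -sumrB; apply: eq_bigr => x _; case: eqP; rewrite ?subrr ?subr0.
elim: s {VW dualE e0 s'} => [|x s IHs]; first by rewrite !big_nil mul1r.
rewrite !big_cons IHs expfzDr ?oppr_eq0 ?oner_neq0 // mulrACA; congr (_ * _).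
rewrite /weight_form1 oppr_eq0; case: eqP => _; first by rewrite mul1r.
by rewrite weight_formN -[- weight_form _]mulN1r expfzMl.
Qed.

(** * Comparison of two vertices *)

Section Comparison.
Variable pi : set (npoint 4).
Hypotheses (sp : solid_partition pi) (fin : finite_asymptotics pi).
Variables (K N : nat).
Hypotheses (bK : shape_bound pi K) (KN : (K <= N)%N).
Variable F : fieldType.
Implicit Types (t : 'I_4 -> F) (i a b : 'I_4).

Local Notation E := (leg_end pi N).
Local Notation Q i := (dual (Pcompl i)).

(** A box that lies in several legs is counted once for each of them. *)
Definition leg_sum (f : npoint 4 -> int) : int :=
  \sum_a \sum_(y <- profile pi a) \sum_(n < N.+1) f (insert_coord a n y).

Lemma laurent_cross_ends i : laurent (cross_ends (F := F) pi N i) 0 0.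
Proof.
have [j ij] : exists j, i != j by exists (lift i 0); rewrite neq_lift.
have [k [l u]] := complete_four ij.
have Lc a b (ai : a != i) (bi : b != i) : laurent
    (fun t => if b == a then 0 else Q i t * E a t * dual (E b) t) 0 0.
  have [ba|ba] := boolP (b == a); first exact: laurent0.
  have [c uc] : exists c, uniq [:: i; a; b; c].
    have [c [d ucd]] := complete_four ai; have := four_cases ucd b.
    case=> bE; rewrite ?bE ?eqxx // in bi ba *.
      by exists d; rewrite /= !inE !(four_neq ucd).
    by exists c; rewrite /= !inE !(four_neq ucd).
  exact: (laurent_cross_compl fin bK KN F uc).
have La b (bi : b != i) : laurent (fun t => Pall t * E b t * dual (E i) t) 0 0.
  exact: (laurent_cross_all fin bK KN F bi).
have H := laurentD
  (laurent_big (index_enum 'I_4) (fun a ai =>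
     laurent_big (index_enum 'I_4) (fun b bi => Lc a b ai bi)))
  (laurent_big (index_enum 'I_4) La).
apply: laurent_ext H _ _ _ => //.
  by rewrite [X in X + _]big1 ?[X in _ + X]big1 // => a _; rewrite big1.
by rewrite [X in X + _]big1 ?[X in _ + X]big1 // => a _; rewrite big1.
Qed.

Lemma laurent_vertex' i : exists r, laurent (vertex' (F := F) pi N i) 0 r.
Proof.
have [j ij] : exists j, i != j by exists (lift i 0); rewrite neq_lift.
have [k [l u]] := complete_four ij.
have [r LA] := laurent_Znor_legs fin N F.
have LX := laurent_square F u (boxed_uniq pi N) (boxed_ideal sp (N := N)).
have LH := laurent_half_leg sp fin N F i.
have LE := laurent_big (index_enum 'I_4) (P := xpredT)
  (fun a _ => laurent_leg_end sp fin bK KN F a).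
have LC := laurent_big (index_enum 'I_4) (P := fun a => a != i) (fun a ai =>
  let L := laurent_leg_end_dual sp fin bK KN F (i := i) (a := a) (etrans (congr1 negb (eq_sym _ _)) ai) in
  laurentB L (laurent_dual L)).
have H := laurentB (laurentB (laurentB (laurentD (laurentB LA LX)
  (laurentB LH (laurent_dual LH))) LE) LC) (laurent_cross_ends i).
eexists; apply: laurent_ext H _ _ _ => [t tt||].
- by rewrite (vertex'E fin bK KN) // /cross_end !ZnorE /dual !ZnorE.
- rewrite sumrN [X in _ - X - _]big1; last by move=> a _; rewrite subrr.
  by rewrite /central; ring.
- by [].
Qed.

Section Difference.
Variables (i j k l : 'I_4).
Hypothesis u : uniq [:: i; j; k; l].

Definition half_square t : F :=
  t j * ((1 - t k) * (1 - t l)) * Znor pi N t * dual (Znor pi N) t.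

(** One half of the anti-self-dual difference of [cross_ends pi N i] and
    [cross_ends pi N j]; one product is chosen for each pair of legs. *)
Definition half_cross t : F :=
  Q i t * E k t * dual (E l) t - Q j t * E k t * dual (E l) t
  + (Q i t * E j t * dual (E k) t + Q i t * E j t * dual (E l) t)
  - (Q j t * E i t * dual (E k) t + Q j t * E i t * dual (E l) t)
  + Pall t * E j t * dual (E i) t.

Definition half_rest (a : 'I_4) t : F :=
  half_leg pi N a t - \sum_(b | b != a) cross_end pi N a b t.

(** The class [U] with [v_i' - v_j' = U - U~]. *)
Definition half_difference t : F :=
  half_rest i t - half_rest j t - half_square t - half_cross t.

(** The relations [Q_i + Q_i~ = Q_j + Q_j~] and [Q_i - Q_j = R - R~] reduce this to a
    polynomial identity in the ends, [X], and their duals. *)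
Lemma vertex'_difference t : torus_point t ->
  vertex' pi N i t - vertex' pi N j t = half_difference t - dual half_difference t.
Proof.
move=> tt.
have dR : dual half_square t =
    t i * ((1 - t k) * (1 - t l)) * Znor pi N t * dual (Znor pi N) t.
  rewrite -(dual_half_factor u tt); set R := fun t => _.
  have -> : dual half_square t = dual R t * dual (Znor pi N) t * dual (dual (Znor pi N)) t.
    by [].
  by rewrite dualK; ring.
have dQ a : dual (Q a) t = Pcompl a t by rewrite dualK.
have dH a : dual (half_rest a) t =
    dual (half_leg pi N a) t - \sum_(b | b != a) dual (cross_end pi N a b) t by [].
have dC : dual half_cross t =
  Pcompl i t * dual (E k) t * E l t - Pcompl j t * dual (E k) t * E l t
  + (Pcompl i t * dual (E j) t * E k t + Pcompl i t * dual (E j) t * E l t)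
  - (Pcompl j t * dual (E i) t * E k t + Pcompl j t * dual (E i) t * E l t)
  + dual (@Pall F) t * dual (E j) t * E i t.
  by rewrite /half_cross {1}/dual !dual_inv.
have dP : dual (@Pall F) t = Pall t.
  by rewrite (Pall_split i tt) /dual (Pall_split i (torus_point_inv tt)) dual_inv addrC.
have -> : dual half_difference t = dual (half_rest i) t - dual (half_rest j) t
   - dual half_square t - dual half_cross t by [].
rewrite !(vertex'E fin bK KN) // /half_difference dR !dH dC dP.
have uj : uniq [:: j; i; k; l] by rewrite /= !inE !(four_neq u).
rewrite /half_rest !sumrB /cross_ends /half_square /half_cross.
rewrite !(big_compl _ _ uj) !(big_compl _ _ u) /= ?eqxx !(four_neq u).
have Qij : Q i t = Q j t + t j * ((1 - t k) * (1 - t l)) - t i * ((1 - t k) * (1 - t l)).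
  rewrite (dual_PcomplE u) // (dual_PcomplE uj) // (PcomplE u) (PcomplE uj).
  by ring.
have Pij : Pcompl i t = Q j t + Pcompl j t - Q i t.
  by rewrite -(Pall_split j tt) (Pall_split i tt); ring.
have Pj := Pall_split j tt.
move: (\sum_a Zleg pi N a t) (\sum_a _) => sY sE.
rewrite Pij Qij Pj.
by ring.
Qed.

Lemma laurent_half_difference :
  laurent half_difference
    (leg_sum (dominant i) - leg_sum (dominant j)
     - \sum_(x <- boxed pi N)
         ([&& x k == x l, (x k <= x i)%N & (x k < x j)%N]%:R
          + [&& x k == x l, (x k <= x j)%N & (x k < x i)%N]%:R)) 0.
Proof.
have LR a : laurent (half_rest a) (leg_sum (dominant a) + leg_sum central) 0.
  have H := laurentB (laurent_half_leg sp fin N F a)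
    (laurent_big (index_enum 'I_4) (P := fun b => b != a) (fun b ba =>
      laurent_leg_end_dual sp fin bK KN F (i := a) (a := b)
        (etrans (congr1 negb (eq_sym _ _)) ba))).
  apply: laurent_ext H _ _ _ => //; last by rewrite big1 ?subr0.
  rewrite /leg_sum -big_split /= [LHS](bigD1 a) //= sumrN opprK; congr (_ + _).
    by rewrite -big_split; apply: eq_bigr => y _; rewrite -big_split.
  apply: eq_bigr => b _.
  by rewrite -big_split; apply: eq_bigr => y _; rewrite -big_split.
have LS := laurent_half_square F u (boxed_uniq pi N) (boxed_ideal sp (N := N)).
have Lc a b c d (uabcd : uniq [:: a; b; c; d]) := laurent_cross_compl fin bK KN F uabcd.
have LC : laurent half_cross 0 0.
  have H := laurentD (laurentB (laurentD (laurentB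
    (Lc i k l j _) (Lc j k l i _)) (laurentD (Lc i j k l _) (Lc i j l k _)))
    (laurentD (Lc j i k l _) (Lc j i l k _))) (laurent_cross_all fin bK KN F (a := j) (b := i) _).
  by apply: laurent_ext (H _ _ _ _ _ _ _) _ _ _ => //; rewrite /= ?inE !(four_neq u).
apply: laurent_ext (laurentB (laurentB (laurentB (LR i) (LR j)) LS) LC) _ _ _.
- by move=> t tt; rewrite /half_difference /half_square ZnorE /dual ZnorE.
- by ring.
- by [].
Qed.

End Difference.
End Comparison.

(** * Independence of the chosen axis *)

Lemma sign_even (F : fieldType) (m n : int) :
  (exists z : int, m = n + 2 * z) -> (-1) ^ m = (-1) ^ n :> F.
Proof.
case=> z ->; rewrite expfzDr ?oppr_eq0 ?oner_neq0 // -exprz_exp.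
by rewrite -[(-1) ^ 2]/((-1) ^+ 2) sqrrN expr1n exp1rz mulr1.
Qed.

(** In the sum over [X], the boxes with [x_k = x_l] below both other coordinates are
    counted twice, and what remains is [a_j = a_k = a_l < a_i] and its analogue for [j].
    The counts over the legs enter [sigma] with the opposite sign, which is immaterial
    modulo 2. *)
Lemma sigma_parity pi K N (i j k l : 'I_4) : finite_asymptotics pi ->
  shape_bound pi K -> (K <= N)%N -> uniq [:: i; j; k; l] ->
  exists z : int, sigma i pi + (0 -
    (leg_sum pi N (dominant i) - leg_sum pi N (dominant j)
     - \sum_(x <- boxed pi N)
         ([&& x k == x l, (x k <= x i)%N & (x k < x j)%N]%:R
          + [&& x k == x l, (x k <= x j)%N & (x k < x i)%N]%:R))) =
  sigma j pi + 2 * z.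
Proof.
move=> fin bK KN u; have uj : uniq [:: j; i; k; l] by rewrite /= !inE !(four_neq u).
rewrite !(sigmaE fin bK _ KN).
(* the boxes that occur in both summands of the sum over X *)
pose both (x : npoint 4) : int := [&& x k == x l, (x k < x i)%N & (x k < x j)%N]%:R.
exists (\sum_(x <- boxed pi N) (dominant i x + both x) + leg_sum pi N (dominant j)
        - leg_sum pi N (dominant i)).
set S := \sum_(x <- boxed pi N) (_%:R + _).
have -> : S = \sum_(x <- boxed pi N) dominant i x + \sum_(x <- boxed pi N) dominant j x
     + 2 * \sum_(x <- boxed pi N) both x.
  rewrite mulr_sumr -!big_split; apply: eq_bigr => x _ /=.
  by rewrite (dominant4 _ u) (dominant4 _ uj) /both; lia.
rewrite big_split /=.
have legE a : \sum_b \sum_(y <- profile pi b) \sum_(n < N.+1)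
    (`[< dominant_diagonal a (insert_coord b n y) >])%:R = leg_sum pi N (dominant a) by [].
have domE a : \sum_(x <- boxed pi N) (`[< dominant_diagonal a x >])%:R =
   \sum_(x <- boxed pi N) dominant a x by [].
rewrite !legE !domE.
by ring.
Qed.

Theorem theorem2p14 (pi : set (npoint 4)) :
  solid_partition pi -> finite_asymptotics pi -> curve_like pi ->
  exists N0 : nat, forall N : nat, (N0 <= N)%N ->
  exists V : 'I_4 -> K0,
    [/\ forall i : 'I_4, K0_ratfun (V i) = vertex' pi N i tgen,
        forall i : 'I_4, movable (V i)
      & forall i j : 'I_4,
          (-1) ^ sigma i pi * euler (- V i) = (-1) ^ sigma j pi * euler (- V j)].
Proof.
move=> sp fin _; have [K bK] := shape_bound_exists sp fin.
exists K => N KN.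
have /choice[s Hs] : forall i, exists s : seq (int * 'rV[int]_3),
    vertex' pi N i tgen = laurent_sum s tgen /\ \sum_(x <- s | x.2 == 0) x.1 = 0.
  move=> i; have [r [s [vE nE _]]] := laurent_vertex' sp fin bK KN ratfun3 i.
  by exists s; rewrite vE //; exact: torus_tgen.
pose V i : K0 := Freeg (s i).
have VE i : K0_ratfun (V i) = vertex' pi N i tgen.
  by rewrite K0_ratfun_Freeg (Hs i).1.
have Vmov i : movable (V i).
  rewrite /movable /V coeff_Freeg -(Hs i).2; exact: eq_bigl.
exists V; split=> // i j.
have [-> //|ij] := eqVneq i j.
have [k [l u]] := complete_four ij.
have [d [dE nE rE]] := laurent_half_difference sp fin bK KN ratfun3 u.
rewrite (@euler_dual_shift (V i) (V j) d) //; last first.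
  rewrite !VE (vertex'_difference fin bK KN u torus_tgen) dE; last exact: torus_tgen.
  by rewrite {1}/dual dE; last exact/torus_point_inv/torus_tgen.
rewrite -rE -nE mulrA -expfzDr ?oppr_eq0 ?oner_neq0 //; congr (_ * _).
exact/sign_even/(sigma_parity fin bK KN u).
Qed.
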